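(* Let $\mathcal{H}_1,\mathcal{H}_2$ be Hilbert spaces, let $\mathcal{S}\subseteq\mathcal{H}_1$ and $\mathcal{T}\subseteq\mathcal{H}_2$ be closed subspaces, and let $A\in L(\mathcal{H}_1,\mathcal{H}_2)$ be $(\mathcal{S},\mathcal{T})$-complementable. Let $$\mathcal{M}^-(A,\mathcal{S},\mathcal{T})=\{C\in L(\mathcal{H}_1,\mathcal{H}_2):\ C\leq^- A,\ R(C)\subseteq\mathcal{T}\text{ and }R(C^* )\subseteq\mathcal{S}\}.$$ Then $A_{/(\mathcal{S},\mathcal{T})}$ is the maximum of $\mathcal{M}^-(A,\mathcal{S},\mathcal{T})$ with respect to $\leq^-$; that is, $A_{/(\mathcal{S},\mathcal{T})}\in\mathcal{M}^-(A,\mathcal{S},\mathcal{T})$ and $C\leq^- A_{/(\mathcal{S},\mathcal{T})}$ for every $C\in\mathcal{M}^-(A,\mathcal{S},\mathcal{T})$.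
   Context: $L(\mathcal{H}_1,\mathcal{H}_2)$ is the space of bounded linear operators; $R(\cdot)$, $N(\cdot)$ denote range and nullspace; $|T|=(T^*T)^{1/2}$. Block form: for closed subspaces $\mathcal{S}\subseteq\mathcal{H}_1$, $\mathcal{T}\subseteq\mathcal{H}_2$, with $P_{\mathcal{M}}$ the orthogonal projection onto $\mathcal{M}$, write $A_{11}=P_{\mathcal{T}}A|_{\mathcal{S}}\in L(\mathcal{S},\mathcal{T})$, $A_{12}=P_{\mathcal{T}}A|_{\mathcal{S}^\perp}\in L(\mathcal{S}^\perp,\mathcal{T})$, $A_{21}=P_{\mathcal{T}^\perp}A|_{\mathcal{S}}\in L(\mathcal{S},\mathcal{T}^\perp)$, $A_{22}=P_{\mathcal{T}^\perp}A|_{\mathcal{S}^\perp}\in L(\mathcal{S}^\perp,\mathcal{T}^\perp)$. $A$ is $(\mathcal{S},\mathcal{T})$-complementable if $R(A_{21})\subseteq R(A_{22})$ and $R(A_{12}^* )\subseteq R(A_{22}^* )$. It is $(\mathcal{S},\mathcal{T})$-weakly complementable if $R(A_{21})\subseteq R(|A_{22}^*|^{1/2})$ and $R(A_{12}^* )\subseteq R(|A_{22}|^{1/2})$. Complementability implies weak complementability. Reduced solution: if $R(Y)\subseteq R(X)$, the reduced solution of $XD=Y$ is the unique bounded $D$ with $XD=Y$ and $R(D)\subseteq N(X)^\perp$. Bilateral shorted operator: for $A$ $(\mathcal{S},\mathcal{T})$-weakly complementable, let $A_{22}=U|A_{22}|$ be the polar decomposition, let $E\in L(\mathcal{S},\mathcal{S}^\perp)$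 be the reduced solution of $A_{21}=|A_{22}^*|^{1/2}UX$ and $F\in L(\mathcal{T},\mathcal{S}^\perp)$ the reduced solution of $A_{12}^*=|A_{22}|^{1/2}X$. Then $A_{/(\mathcal{S},\mathcal{T})}\in L(\mathcal{H}_1,\mathcal{H}_2)$ is the operator with block form $\begin{pmatrix}A_{11}-F^*E&0\\0&0\end{pmatrix}$ relative to $\mathcal{S}\oplus\mathcal{S}^\perp$ and $\mathcal{T}\oplus\mathcal{T}^\perp$. Dixmier cosine: for closed subspaces $\mathcal{M},\mathcal{N}$ of a Hilbert space, $c_0[\mathcal{M},\mathcal{N}]=\sup\{|\langle x,y\rangle|: x\in\mathcal{M},\ y\in\mathcal{N},\ \|x\|=\|y\|=1\}$ (value $0$ if one subspace is $\{0\}$). Minus order: for $A,B\in L(\mathcal{H}_1,\mathcal{H}_2)$, $A\leq^- B$ means $c_0[\overline{R(A)},\overline{R(B-A)}]<1$ and $c_0[\overline{R(A^* )},\overline{R(B^*-A^* )}]<1$. (This is a partial order.) *)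

(* Defs.v *)
From HB Require Import structures.
From mathcomp Require Import all_boot all_order all_algebra.
From mathcomp Require Import complex.
From mathcomp Require Import all_classical all_reals all_analysis.

Set Implicit Arguments.
Unset Strict Implicit.
Unset Printing Implicit Defensive.

Import Order.TTheory GRing.Theory Num.Theory.
Import numFieldNormedType.Exports.

Local Open Scope classical_set_scope.
Local Open Scope ring_scope.

(* Complex Hilbert spaces; the inner product is linear in its first argument
   and norms take their values in R[i]. *)
HB.mixin Record CompleteNormedModule_isHilbert (R : realType) H
    & CompleteNormedModule R[i] H := {
  inner : {dot H for (@Num.conj R[i])} ;
  sqr_norm_inner : forall x : H, `|x| ^+ 2 = inner x x
}.

#[short(type="hilbertType")]
HB.structure Definition Hilbert (R : realType) :=
  {H of CompleteNormedModule R[i] H & CompleteNormedModule_isHilbert R H}.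

Notation "''[' x , y ]" := (inner x y) : ring_scope.

Section InnerTheory.
Context {R : realType} {H : hilbertType R}.
Implicit Types x y z : H.

Lemma innerDl z x y : '[x + y, z] = '[x, z] + '[y, z].
Proof. exact: linearDl. Qed.

Lemma innerZl z (a : R[i]) x : '[a *: x, z] = a * '[x, z].
Proof. exact: linearZl_LR. Qed.

Lemma innerC x y : '[x, y] = ('[y, x])^*.
Proof. by rewrite hermC expr0 mul1r. Qed.

Lemma inner0l z : '[0, z] = 0.
Proof. exact: linear0l. Qed.

Lemma innerBl z x y : '[x - y, z] = '[x, z] - '[y, z].
Proof. exact: linearBl. Qed.

Lemma innerBr z x y : '[z, x - y] = '[z, x] - '[z, y].
Proof. exact: linearBr. Qed.

Lemma innerZr z (a : R[i]) x : '[z, a *: x] = a^* * '[z, x].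
Proof. exact: linearZr_LR. Qed.

Lemma inner_eq0C x y : ('[x, y] == 0) = ('[y, x] == 0).
Proof. by rewrite innerC fmorph_eq0. Qed.

Lemma CauchySchwarz_inner x y : `|'[x, y]| <= `|x| * `|y|.
Proof.
have [->|y0] := eqVneq y 0; first by rewrite linear0r !normr0 mulr0.
pose a := '[x, y] / '[y, y].
have yy : '[y, y] != 0 by rewrite -sqr_norm_inner expf_neq0 ?normr_eq0.
have o : '[x - a *: y, y] = 0 by rewrite innerBl innerZl /a divfK ?subrr.
have oa : '[x - a *: y, a *: y] = 0 by rewrite linearZr_LR /= o mulr0.
have E : `|x| ^+ 2 = `|x - a *: y| ^+ 2 + `|a *: y| ^+ 2.
  by rewrite -[X in `|X| ^+ 2](subrK (a *: y)) sqr_norm_inner hnormDd // !sqr_norm_inner.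
have le : `|a *: y| <= `|x|.
  by rewrite -ler_sqr ?nnegrE // E lerDr exprn_ge0.
have -> : `|'[x, y]| = `|a *: y| * `|y|.
  by rewrite normrZ -mulrA -expr2 -{1}(normr_id y) -normrX -normrM sqr_norm_inner /a divfK.
by rewrite ler_wpM2r.
Qed.

End InnerTheory.

Record csubspace (R : realType) (H : hilbertType R) := Csubspace {
  cs_set : set H ;
  cs_submod : submod_closed [in cs_set] ;
  cs_closed : closed cs_set
}.

Section Csubspace.
Context {R : realType} {H : hilbertType R}.
Variable S : csubspace H.

Definition cs_pred : {pred H} := [in cs_set S].
HB.instance Definition _ := GRing.isSubmodClosed.Build R[i] H cs_pred (cs_submod S).

Record cs_type := CsElt { cs_val : H ; _ : cs_val \in cs_pred }.

HB.instance Definition _ := [isSub for cs_val].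
HB.instance Definition _ := [Choice of cs_type by <:].
HB.instance Definition _ := [SubChoice_isSubLmodule of cs_type by <:].

Let nrm (x : cs_type) : R[i] := `|val x|.
Let ler_nrmD x y : nrm (x + y) <= nrm x + nrm y.
Proof. by rewrite /nrm raddfD ler_normD. Qed.
Let nrmZ (l : R[i]) x : nrm (l *: x) = `|l| * nrm x.
Proof. by rewrite /nrm linearZ normrZ. Qed.
Let nrm_eq0 x : nrm x = 0 -> x = 0.
Proof. by move=> /normr0_eq0 x0; apply: val_inj; rewrite x0 raddf0. Qed.
HB.instance Definition _ :=
  Lmodule_isNormed.Build R[i] cs_type ler_nrmD nrmZ nrm_eq0.

Lemma cs_normE (x : cs_type) : `|x| = `|val x|. Proof. by []. Qed.

Let cs_complete (F : set_system cs_type) : ProperFilter F -> cauchy F -> cvg F.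
Proof.
move=> FF /cauchy_ballP Fc.
have Gc : cauchy ((val : cs_type -> H) @ F).
  apply/cauchy_ballP => e e0; have := Fc e e0.
  rewrite !near_simpl => -[[A B] /= [FA FB] AB].
  exists (val @` A, val @` B) => /=.
    by split; [apply: filterS FA|apply: filterS FB] => x Ax; exists x.
  move=> [_ _] /= [[x Ax <-] [y By <-]].
  have := AB (x, y) (conj Ax By).
  by rewrite -!ball_normE /= cs_normE raddfB.
have /cauchy_cvgP cvgG := Gc.
have /set_mem lS : lim ((val : cs_type -> H) @ F) \in cs_set S.
  apply/mem_set.
  have Sx : \forall x \near F, cs_set S (val x).
    by apply: nearW => x; exact/set_mem/(valP x).
  exact: (closed_cvg (cs_set S) (@cs_closed _ _ S) Sx _ cvgG).
pose l : cs_type := CsElt (mem_set lS).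
apply/cvg_ex; exists l; apply/cvgrPdist_lt => e e0.
have /cvgrPdist_lt /(_ e e0) := cvgG.
rewrite !near_simpl; apply: filterS => x.
by [].
Qed.
HB.instance Definition _ := Uniform_isComplete.Build cs_type cs_complete.

Definition cs_inner (x y : cs_type) : R[i] := '[val x, val y].

Let cs_inner_zmodl u : zmod_morphism (cs_inner^~ u).
Proof. by move=> x y; rewrite /cs_inner raddfB innerBl. Qed.
Let cs_inner_zmodr u : zmod_morphism (cs_inner u).
Proof. by move=> x y; rewrite /cs_inner !raddfB. Qed.
Let cs_innerZl u : scalable_for *%R (cs_inner^~ u).
Proof. by move=> a x; rewrite /cs_inner linearZ innerZl. Qed.
Let cs_innerZr u : scalable_for (Num.conj \; *%R) (cs_inner u).
Proof. by move=> a x; rewrite /cs_inner linearZ. Qed.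
HB.instance Definition _ := isBilinear.Build R[i] cs_type cs_type R[i]
  *%R (Num.conj \; *%R) cs_inner
  cs_inner_zmodl cs_inner_zmodr cs_innerZl cs_innerZr.

Let cs_inner_herm x y : cs_inner x y = (-1) ^+ false * (cs_inner y x)^*.
Proof. by rewrite /cs_inner hermC. Qed.
HB.instance Definition _ :=
  isHermitianSesquilinear.Build R[i] cs_type false Num.conj cs_inner
    cs_inner_herm.

Let cs_inner_gt0 u : u != 0 -> 0 < cs_inner u u.
Proof.
by move=> u0; rewrite /cs_inner -sqr_norm_inner -cs_normE exprn_gt0 ?normr_gt0.
Qed.
HB.instance Definition _ := isDotProduct.Build R[i] cs_type cs_inner cs_inner_gt0.

Let sqr_norm_cs_inner (x : cs_type) : `|x| ^+ 2 = cs_inner x x.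
Proof. by rewrite cs_normE sqr_norm_inner. Qed.
HB.instance Definition _ := CompleteNormedModule_isHilbert.Build R cs_type
  sqr_norm_cs_inner.

Lemma cs_innerE (x y : cs_type) : '[x, y] = '[val x, val y]. Proof. by []. Qed.

Definition cs_hilbert : hilbertType R := cs_type.

End Csubspace.

Coercion cs_hilbert : csubspace >-> hilbertType.

Section OrthogonalComplement.
Context {R : realType} {H : hilbertType R}.
Variable X : set H.

Let ortho : set H := [set x | forall y, X y -> '[x, y] = 0].

Let ortho_submod : submod_closed [in ortho].
Proof.
split=> [|a x y /set_mem xX /set_mem yX]; apply/mem_set => z Xz.
  exact: inner0l.
by rewrite innerDl innerZl xX // yX // mulr0 addr0.
Qed.

Let ortho_closed : closed ortho.
Proof.
move=> x clx y Xy; apply/eqP/negPn/negP => xy0.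
have y0 : 0 < `|y|.
  by rewrite normr_gt0; apply: contra_neq xy0 => ->; rewrite linear0r.
have e0 : 0 < `|'[x, y]| / `|y| by rewrite divr_gt0 // normr_gt0.
have [z [oz]] := clx _ (nbhsx_ballx x _ e0).
rewrite -ball_normE /= => xz.
have := CauchySchwarz_inner (x - z) y.
rewrite innerBl (oz _ Xy) subr0 => /le_lt_trans.
by move=> /(_ `|'[x, y]|); rewrite -ltr_pdivlMr // ltxx => /(_ xz).
Qed.

Definition orthoc : csubspace H := Csubspace ortho_submod ortho_closed.

End OrthogonalComplement.

Record bop (R : realType) (H1 H2 : hilbertType R) := Bop {
  bop_fun :> H1 -> H2 ;
  bop_linear : linear bop_fun ;
  bop_bounded : exists M : R[i], forall x, `|bop_fun x| <= M * `|x|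
}.

Notation "''L(' H1 , H2 )" := (bop H1 H2) (format "''L(' H1 ,  H2 )")
  : type_scope.

HB.instance Definition _ (R : realType) (H1 H2 : hilbertType R) :=
  gen_eqMixin 'L(H1, H2).
HB.instance Definition _ (R : realType) (H1 H2 : hilbertType R) :=
  gen_choiceMixin 'L(H1, H2).
HB.instance Definition _ (R : realType) (H1 H2 : hilbertType R)
    (A : 'L(H1, H2)) :=
  GRing.isLinear.Build R[i] H1 H2 *:%R A (bop_linear A).

Section BoundedOperators.
Context {R : realType}.
Implicit Types H : hilbertType R.

Lemma bopP H1 H2 (A B : 'L(H1, H2)) : A =1 B -> A = B.
Proof.
case: A B => [f fl fb] [g gl gb] /= /funext fg.
by subst g; congr Bop; exact: Prop_irrelevance.
Qed.

Section Zmodule.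
Variables H1 H2 : hilbertType R.
Implicit Types A B : 'L(H1, H2).

Let lin0 : linear (fun _ : H1 => 0 : H2).
Proof. by move=> a x y; rewrite scaler0 addr0. Qed.
Let bnd0 : exists M : R[i], forall x : H1, `|0 : H2| <= M * `|x|.
Proof. by exists 0 => x; rewrite normr0 mul0r. Qed.
Definition bop0 : 'L(H1, H2) := Bop lin0 bnd0.

Let linN A : linear (fun x => - A x).
Proof. by move=> a x y; rewrite linearP opprD scalerN. Qed.
Let bndN A : exists M : R[i], forall x, `|- A x| <= M * `|x|.
Proof. by have [M AM] := bop_bounded A; exists M => x; rewrite normrN. Qed.
Definition bop_opp A : 'L(H1, H2) := Bop (linN A) (bndN A).

Let linD A B : linear (fun x => A x + B x).
Proof. by move=> a x y; rewrite !linearP scalerDr addrACA. Qed.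
Let bndD A B : exists M : R[i], forall x, `|A x + B x| <= M * `|x|.
Proof.
have [M AM] := bop_bounded A; have [N BN] := bop_bounded B; exists (M + N) => x.
by rewrite mulrDl (le_trans (ler_normD _ _)) ?lerD.
Qed.
Definition bop_add A B : 'L(H1, H2) := Bop (linD A B) (bndD A B).

Let addA : associative bop_add.
Proof. by move=> A B D; apply: bopP => x; exact: addrA. Qed.
Let addC : commutative bop_add.
Proof. by move=> A B; apply: bopP => x; exact: addrC. Qed.
Let add0 : left_id bop0 bop_add.
Proof. by move=> A; apply: bopP => x; exact: add0r. Qed.
Let addN : left_inverse bop0 bop_opp bop_add.
Proof. by move=> A; apply: bopP => x; exact: addNr. Qed.
HB.instance Definition _ :=
  GRing.isZmodule.Build 'L(H1, H2) addA addC add0 addN.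

End Zmodule.

Section Composition.
Variables H1 H2 H3 : hilbertType R.
Variables (B : 'L(H2, H3)) (A : 'L(H1, H2)).

Let lin_comp : linear (B \o A).
Proof. by move=> a x y /=; rewrite !linearP. Qed.
Let bnd_comp : exists M : R[i], forall x, `|(B \o A) x| <= M * `|x|.
Proof.
have [M AM] := bop_bounded A; have [N BN] := bop_bounded B.
exists (`|N| * M) => x /=; rewrite -mulrA (le_trans (BN _)) //.
have [N0|N0] := eqVneq `|A x| 0; first by rewrite N0 mulr0 mulr_ge0 // -N0.
have Nge0 : 0 <= N.
  have Ax0 : 0 < `|A x| by rewrite lt_def N0 normr_ge0.
  by rewrite -(pmulr_lge0 _ Ax0) (le_trans _ (BN _)).
by rewrite ger0_norm // ler_wpM2l.
Qed.
Definition bop_comp : 'L(H1, H3) := Bop lin_comp bnd_comp.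

End Composition.

End BoundedOperators.

Notation "B \bo A" := (bop_comp B A) (at level 40, left associativity).

Section OperatorTheory.
Context {R : realType}.
Implicit Types H : hilbertType R.

(* [xget 0 P] is an element of P, or 0 if P is empty. The adjoint, the positive
   square root of a positive operator, the polar decomposition, the orthogonal
   projection and (when R(Y) is included in R(X)) the reduced solution exist and
   are unique, so each is the only element of the set it is chosen from. *)

Definition adjoint H1 H2 (A : 'L(H1, H2)) : 'L(H2, H1) :=
  xget 0 [set B : 'L(H2, H1) | forall x y, '[A x, y] = '[x, B y]].

Definition kernel H1 H2 (A : 'L(H1, H2)) : set H1 := [set x | A x = 0].

(* As H is complex, this implies that T is self-adjoint. *)
Definition positive_op H (T : 'L(H, H)) := forall x, 0 <= '[T x, x].

Definition sqrt_op H (T : 'L(H, H)) : 'L(H, H) :=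
  xget 0 [set Q : 'L(H, H) | positive_op Q /\ Q \bo Q = T].

Definition abs_op H1 H2 (T : 'L(H1, H2)) : 'L(H1, H1) :=
  sqrt_op (adjoint T \bo T).

Definition partial_isometry H1 H2 (U : 'L(H1, H2)) :=
  forall x, cs_set (orthoc (kernel U)) x -> `|U x| = `|x|.

Definition polar_factor H1 H2 (T : 'L(H1, H2)) : 'L(H1, H2) :=
  xget 0 [set U : 'L(H1, H2) |
    [/\ partial_isometry U, kernel U = kernel T & T = U \bo abs_op T]].

Definition reduced_solution H1 H2 H3
    (X : 'L(H2, H3)) (Y : 'L(H1, H3)) : 'L(H1, H2) :=
  xget 0 [set D : 'L(H1, H2) |
    X \bo D = Y /\ range D `<=` cs_set (orthoc (kernel X))].

Section Inclusion.
Variables (H : hilbertType R) (S : csubspace H).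

Let incl_linear : linear (fun x : S => cs_val x).
Proof. by move=> a x y; exact: (linearP (val : cs_type S -> H)). Qed.
Let incl_bounded : exists M : R[i], forall x : S, `|cs_val x| <= M * `|x|.
Proof. by exists 1 => x; rewrite mul1r. Qed.
Definition cs_incl : 'L(S, H) := Bop incl_linear incl_bounded.

(* The orthogonal projection onto S, with codomain S. *)
Definition cs_proj : 'L(H, S) :=
  xget 0 [set P : 'L(H, S) |
    forall (x : H) (s : S), '[x - cs_incl (P x), cs_incl s] = 0].

End Inclusion.

Definition cs_perp H (S : csubspace H) : csubspace H := orthoc (cs_set S).

Section Shorted.
Variables (H1 H2 : hilbertType R) (S : csubspace H1) (T : csubspace H2).
Implicit Types A : 'L(H1, H2).

Definition block11 A : 'L(S, T) := cs_proj T \bo A \bo cs_incl S.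
Definition block12 A : 'L(cs_perp S, T) :=
  cs_proj T \bo A \bo cs_incl (cs_perp S).
Definition block21 A : 'L(S, cs_perp T) :=
  cs_proj (cs_perp T) \bo A \bo cs_incl S.
Definition block22 A : 'L(cs_perp S, cs_perp T) :=
  cs_proj (cs_perp T) \bo A \bo cs_incl (cs_perp S).

Definition block_op (B11 : 'L(S, T)) (B12 : 'L(cs_perp S, T))
    (B21 : 'L(S, cs_perp T)) (B22 : 'L(cs_perp S, cs_perp T)) : 'L(H1, H2) :=
  cs_incl T \bo (B11 \bo cs_proj S + B12 \bo cs_proj (cs_perp S))
  + cs_incl (cs_perp T) \bo (B21 \bo cs_proj S + B22 \bo cs_proj (cs_perp S)).

Definition complementable A :=
  range (block21 A) `<=` range (block22 A) /\
  range (adjoint (block12 A)) `<=` range (adjoint (block22 A)).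

Definition weakly_complementable A :=
  range (block21 A) `<=` range (sqrt_op (abs_op (adjoint (block22 A)))) /\
  range (adjoint (block12 A)) `<=` range (sqrt_op (abs_op (block22 A))).

(* Meaningful for weakly complementable A, and in particular for complementable
   A. *)
Definition bilateral_shorted A : 'L(H1, H2) :=
  let U := polar_factor (block22 A) in
  let E : 'L(S, cs_perp S) :=
    reduced_solution (sqrt_op (abs_op (adjoint (block22 A))) \bo U)
                     (block21 A) in
  let F : 'L(T, cs_perp S) :=
    reduced_solution (sqrt_op (abs_op (block22 A))) (adjoint (block12 A)) in
  block_op (block11 A - adjoint F \bo E) 0 0 0.

End Shorted.

(* As [sup set0 = 0], the value is 0 if M or N is {0}. *)
Definition dixmier_cos H (M N : set H) : R :=
  sup [set c : R | exists x y,
    [/\ M x, N y, `|x| = 1, `|y| = 1 & c%:C%C = `|'[x, y]|]].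

Definition minus_le H1 H2 (A B : 'L(H1, H2)) :=
  dixmier_cos (closure (range A)) (closure (range (B - A))) < 1 /\
  dixmier_cos (closure (range (adjoint A)))
              (closure (range (adjoint B - adjoint A))) < 1.

Definition minus_lower_set H1 H2 (A : 'L(H1, H2)) (S : csubspace H1)
    (T : csubspace H2) : set 'L(H1, H2) :=
  [set C | [/\ minus_le C A, range C `<=` cs_set T &
           range (adjoint C) `<=` cs_set S]].

End OperatorTheory.

(* Main.v *)
Require Import Defs.
From HB Require Import structures.
From mathcomp Require Import all_boot all_order all_algebra.
From mathcomp Require Import complex.
From mathcomp Require Import all_classical all_reals all_analysis.
From mathcomp Require Import ring lra.

Set Implicit Arguments.
Unset Strict Implicit.
Unset Printing Implicit Defensive.

Import Order.TTheory GRing.Theory Num.Theory.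
Import numFieldNormedType.Exports.

Local Open Scope classical_set_scope.
Local Open Scope ring_scope.

(* The Schur complement is an oblique compression. Write A22 D = A21 and
   A22* G = A12* (bounded solutions exist by complementability and Douglas'
   lemma). For the shorted operator W, intertwining |A22|^(1/2) and |A22*|^(1/2)
   with A22 gives F* E = G* A21 = A12 D, so W = A P = Q A with P the idempotent
   of range {s - D s} and kernel S^perp, and Q the adjoint of the analogous
   idempotent for A*. A bounded idempotent separates its range from its kernel
   by a positive angle, whence W <=^- A. If C <=^- A with R(C) in T and R(C* ) in S,
   then C P = C = Q C, so W - C = (A - C) P and W* - C* = (Q (A - C))* have
   ranges inside those of A - C and A* - C*, and the angles only grow. *)

(** * Real-valued norm *)

Section RealNorm.
Context {R : realType}.
Implicit Types H : hilbertType R.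

(** The definitions pick adjoints, projections, square roots, polar factors and reduced solutions by
    [xget], which returns 0 on an empty set; each of these objects must therefore be shown to exist,
    and this is where completeness enters. The obstacle is that E and F are defined through the
    polar factor U and square roots of moduli, whereas complementability speaks of A22 alone. The
    bridge is A22 = |A22*|^(1/2) U |A22|^(1/2), which lets E and F be compared with D and G. The two
    factorisations of W have different tasks. W = Q A puts R(W) in the range of Q and R(A - W) in
    its kernel, and W = A P does the same for the adjoints. In the maximality part the tasks are
    exchanged: multiplying A - C by P on the right keeps the range inside R(A - C), and Q serves the
    adjoints. *)

Definition cmod (z : R[i]) : R := complex.Re `|z|.

Lemma cmodE (z : R[i]) : `|z| = (cmod z)%:C%C.
Proof. by rewrite /cmod RRe_real // ger0_real. Qed.

(** The norm of the structure is [R[i]]-valued; a real-valued copy lets estimates, infima and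
    suprema live in the ordered field R. *)
Definition rnorm H (x : H) : R := complex.Re `|x|.
Definition rinner H (x y : H) : R := complex.Re '[x, y].

Lemma rnormE H (x : H) : `|x| = (rnorm x)%:C%C.
Proof. by rewrite /rnorm RRe_real // ger0_real. Qed.

Lemma rnorm_ge0 H (x : H) : 0 <= rnorm x.
Proof. by rewrite -ler0c -rnormE. Qed.

Lemma rnorm_eq0 H (x : H) : rnorm x = 0 -> x = 0.
Proof. by move=> x0; apply/normr0_eq0; rewrite rnormE x0. Qed.

Lemma rnorm0 H : rnorm (0 : H) = 0.
Proof. by rewrite /rnorm normr0. Qed.

Lemma rnorm_gt0 H (x : H) : x != 0 -> 0 < rnorm x.
Proof.
by move=> x0; rewrite lt_neqAle rnorm_ge0 andbT eq_sym; apply: contra_neq x0 => /rnorm_eq0.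
Qed.

Lemma rnormN H (x : H) : rnorm (- x) = rnorm x.
Proof. by rewrite /rnorm normrN. Qed.

Lemma rnormBC H (x y : H) : rnorm (x - y) = rnorm (y - x).
Proof. by rewrite -rnormN opprB. Qed.

Lemma rnormD H (x y : H) : rnorm (x + y) <= rnorm x + rnorm y.
Proof. by rewrite -lecR rmorphD /= -!rnormE ler_normD. Qed.

Lemma rnormB H (x y : H) : rnorm (x - y) <= rnorm x + rnorm y.
Proof. by rewrite -(rnormN y); exact: rnormD. Qed.

Lemma rnormZ H (a : R[i]) (x : H) : rnorm (a *: x) = cmod a * rnorm x.
Proof. by apply: complexI; rewrite rmorphM /= -!rnormE normrZ cmodE. Qed.

Lemma rnormZr H (a : R) (x : H) : rnorm (a%:C%C *: x) = `|a| * rnorm x.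
Proof. by rewrite rnormZ /cmod normc_def /= expr0n addr0 sqrtr_sqr. Qed.

Lemma rnorm_sqr H (x : H) : rnorm x ^+ 2 = rinner x x.
Proof. by rewrite /rinner -sqr_norm_inner rnormE -rmorphXn. Qed.

Lemma inner_rnorm H (x : H) : '[x, x] = (rnorm x ^+ 2)%:C%C.
Proof. by rewrite -sqr_norm_inner rnormE rmorphXn. Qed.

Lemma innerDr H (x y z : H) : '[z, x + y] = '[z, x] + '[z, y].
Proof. exact: linearDr. Qed.

Lemma inner0r H (x : H) : '[x, 0] = 0.
Proof. exact: linear0r. Qed.

Lemma rinnerC H (x y : H) : rinner x y = rinner y x.
Proof. by rewrite /rinner innerC; case: '[y, x]. Qed.

Lemma rinnerDl H (x y z : H) : rinner (x + y) z = rinner x z + rinner y z.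
Proof. by rewrite /rinner innerDl raddfD. Qed.

Lemma rinnerDr H (x y z : H) : rinner z (x + y) = rinner z x + rinner z y.
Proof. by rewrite !(rinnerC z) rinnerDl. Qed.

Lemma rinnerZl H (a : R) (x y : H) : rinner (a%:C%C *: x) y = a * rinner x y.
Proof. by rewrite /rinner innerZl; case: '[x, y] => u v /=; rewrite mul0r subr0. Qed.

Lemma rinnerZr H (a : R) (x y : H) : rinner x (a%:C%C *: y) = a * rinner x y.
Proof. by rewrite !(rinnerC x) rinnerZl. Qed.

Lemma rinnerNl H (x y : H) : rinner (- x) y = - rinner x y.
Proof. by rewrite -scaleN1r -[X in X *: _](_ : (-1)%:C%C = _) ?rinnerZl ?mulN1r // rmorphN1. Qed.

Lemma rinnerNr H (x y : H) : rinner x (- y) = - rinner x y.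
Proof. by rewrite !(rinnerC x) rinnerNl. Qed.

Definition rinnerE := (rinnerDl, rinnerDr, rinnerNl, rinnerNr, rinnerZl, rinnerZr).

Lemma rnormD_sqr H (x y : H) :
  rnorm (x + y) ^+ 2 = rnorm x ^+ 2 + 2 * rinner x y + rnorm y ^+ 2.
Proof. rewrite !rnorm_sqr !rinnerE (rinnerC y x); ring. Qed.

Lemma rnormB_sqr H (x y : H) :
  rnorm (x - y) ^+ 2 = rnorm x ^+ 2 - 2 * rinner x y + rnorm y ^+ 2.
Proof. rewrite !rnorm_sqr !rinnerE (rinnerC y x); ring. Qed.

Lemma rnorm_CauchySchwarz H (x y : H) : cmod '[x, y] <= rnorm x * rnorm y.
Proof.
by rewrite -lecR rmorphM /= -!rnormE -cmodE CauchySchwarz_inner.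
Qed.

Lemma ler_normRe (z : R[i]) : `|complex.Re z| <= cmod z.
Proof.
case: z => a b; rewrite /cmod normc_def /= -sqrtr_sqr ler_sqrt ?lerDl ?sqr_ge0 //.
by rewrite addr_ge0 ?sqr_ge0.
Qed.

Lemma ler_rinner H (x y : H) : `|rinner x y| <= rnorm x * rnorm y.
Proof. exact: le_trans (ler_normRe _) (rnorm_CauchySchwarz _ _). Qed.

(** The second argument is conjugate-linear, so pairing with i y turns the imaginary part into a
    real part. Orthogonality can thus be tested on real parts alone. *)
Lemma rinner_inner H (x y : H) :
  '[x, y] = (rinner x y +i* rinner x ('i%C *: y))%C.
Proof.
by rewrite /rinner innerZr; case: '[x, y] => u v /=; rewrite mul0r mulN1r opprK add0r.
Qed.

Lemma rinner_inner0 H (x y : H) :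
  rinner x y = 0 -> rinner x ('i%C *: y) = 0 -> '[x, y] = 0.
Proof. by move=> xy xiy; rewrite rinner_inner xy xiy. Qed.

Lemma inner_self0 H (x : H) : '[x, x] = 0 -> x = 0.
Proof.
by rewrite inner_rnorm => -[/eqP]; rewrite sqrf_eq0 => /eqP /rnorm_eq0.
Qed.

Lemma inner_inj H (x y : H) : (forall z, '[x, z] = '[y, z]) -> x = y.
Proof. by move=> xy; apply/subr0_eq/inner_self0; rewrite innerBl xy subrr. Qed.

Lemma inner_injr H (x y : H) : (forall z, '[z, x] = '[z, y]) -> x = y.
Proof. by move=> xy; apply: inner_inj => z; rewrite innerC xy -innerC. Qed.

Lemma closureP H (X : set H) (x : H) :
  closure X x <-> forall e : R, 0 < e -> exists2 y, X y & rnorm (x - y) < e.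
Proof.
split=> [clx e e0|clx B].
  have [|y [Xy]] := clx (ball x e%:C%C); first by apply: nbhsx_ballx; rewrite ltcR.
  by rewrite -ball_normE /= rnormE ltcR; exists y.
move=> /nbhs_ballP [e /= e0 eB].
have eE : e = (complex.Re e)%:C%C by rewrite RRe_real // gtr0_real.
have [|y Xy xy] := clx (complex.Re e); first by rewrite -ltcR -eE.
by exists y; split => //; apply: eB; rewrite -ball_normE /= rnormE eE ltcR.
Qed.

(* Cantor's intersection theorem, as a filter-free form of completeness. *)
Lemma nested_sets_limit H (P : R -> set H) :
  (forall e : R, 0 < e -> P e !=set0) ->
  (forall e e' : R, 0 < e -> e <= e' -> P e `<=` P e') ->
  (forall (e : R) x y, 0 < e -> P e x -> P e y -> rnorm (x - y) <= e) ->
  exists l, forall (e : R) x, 0 < e -> P e x -> rnorm (x - l) <= e.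
Proof.
move=> P0 Pmono Pdiam.
pose F := filter_from [set e : R | 0 < e] P.
have FF : ProperFilter F.
  apply: filter_from_proper; last by move=> e /= /P0.
  apply: filter_from_filter; first by exists 1; exact: ltr01.
  move=> e e' /= e0 e'0; have m0 : 0 < Num.min e e' by rewrite lt_min e0.
  by exists (Num.min e e') => // x Px; split; apply: Pmono Px; rewrite ?ge_min ?lexx ?orbT.
have Fc : cauchy F.
  apply/cauchy_ballP => e e0; near_simpl.
  have eE : e = (complex.Re e)%:C%C by rewrite RRe_real // gtr0_real.
  have r0 : 0 < complex.Re e by rewrite -ltcR -eE.
  have r20 : 0 < complex.Re e / 2 by rewrite divr_gt0.
  exists (P (complex.Re e / 2), P (complex.Re e / 2)) => /=.
    by split; exists (complex.Re e / 2).
  move=> [x y] /= [Px Py]; rewrite -ball_normE /= rnormE eE ltcR.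
  by apply: le_lt_trans (Pdiam _ _ _ r20 Px Py) _; rewrite gtr_pMr // invf_lt1 // ltr1n.
have [l Fl] : exists l : H, F --> l by apply/cvg_ex/cauchy_cvgP.
exists l => e x e0 Px; apply/ler_addgt0Pr => d d0.
have dC0 : 0 < d%:C%C by rewrite ltcR.
have [e' /= e'0 Pe'] := Fl _ (nbhsx_ballx l _ dC0).
have m0 : 0 < Num.min e e' by rewrite lt_min e0.
have [y Py] := P0 _ m0.
have Pey : P e y by apply: Pmono Py; rewrite ?ge_min ?lexx.
have Pe'y : P e' y by apply: Pmono Py; rewrite ?ge_min ?lexx ?orbT.
have := Pe' _ Pe'y; rewrite -ball_normE /= rnormE ltcR => /ltW; rewrite (rnormBC l) => yl.
rewrite -(subrK y x) -addrA.
by apply: le_trans (rnormD _ _) _; exact: lerD (Pdiam _ _ _ e0 Px Pey) yl.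
Qed.

End RealNorm.

(** * Projection and Riesz theorems *)

Section Projection.
Context {R : realType}.
Implicit Types H : hilbertType R.

Lemma csubspace0 H (S : csubspace H) : cs_set S 0.
Proof. by have [/set_mem] := cs_submod S. Qed.

Lemma csubspaceP H (S : csubspace H) (a : R[i]) x y :
  cs_set S x -> cs_set S y -> cs_set S (a *: x + y).
Proof.
by move=> Sx Sy; have [_ SP] := cs_submod S; apply/set_mem/SP; exact/mem_set.
Qed.

Lemma csubspaceZ H (S : csubspace H) (a : R[i]) x :
  cs_set S x -> cs_set S (a *: x).
Proof. by move=> Sx; rewrite -[_ *: _]addr0; apply: csubspaceP => //; exact: csubspace0. Qed.

Lemma csubspaceD H (S : csubspace H) x y :
  cs_set S x -> cs_set S y -> cs_set S (x + y).
Proof. by move=> Sx; rewrite -{1}(scale1r x); exact: csubspaceP. Qed.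

Lemma csubspaceB H (S : csubspace H) x y :
  cs_set S x -> cs_set S y -> cs_set S (x - y).
Proof. by move=> Sx Sy; rewrite addrC -scaleN1r; exact: csubspaceP. Qed.

Lemma csubspace_closure H (S : csubspace H) x : closure (cs_set S) x -> cs_set S x.
Proof. exact: cs_closed. Qed.

Lemma ler_of_sqr (a b : R) : 0 <= b -> a ^+ 2 <= b ^+ 2 -> a <= b.
Proof. by move=> b0 ab; rewrite (le_trans (ler_norm a)) // -ler_sqr ?nnegrE // real_normK ?num_real. Qed.

(** First-order optimality at t = 0. The test point b / (c + 1), rather than the minimiser b / c,
    also covers c = 0. *)
Lemma quadratic_ge0_linear0 (b c : R) : 0 <= c ->
  (forall t : R, 0 <= t ^+ 2 * c - 2 * t * b) -> b = 0.
Proof.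
move=> c0 tP.
have := tP (b / (c + 1)).
have c1 : 0 < c + 1 by lra.
have -> : (b / (c + 1)) ^+ 2 * c - 2 * (b / (c + 1)) * b
  = - ((b / (c + 1)) ^+ 2 * (c + 2)).
  by field; rewrite gt_eqF.
rewrite oppr_ge0 pmulr_lle0; last by lra.
move=> le0; have /eqP : (b / (c + 1)) ^+ 2 = 0.
  by apply: le_anti; rewrite le0 sqr_ge0.
by rewrite sqrf_eq0 mulf_eq0 invr_eq0 (gt_eqF c1) orbF => /eqP.
Qed.

Lemma orthogonal_projection H (S : csubspace H) (x : H) :
  exists2 p, cs_set S p & forall s, cs_set S s -> '[x - p, s] = 0.
Proof.
pose D := [set rnorm (x - s) ^+ 2 | s in cs_set S].
have D0 : D !=set0 by exists (rnorm (x - 0) ^+ 2); exists 0 => //; exact: csubspace0.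
have lbD : has_lbound D by exists 0 => _ [s _ <-]; exact: sqr_ge0.
pose d := inf D.
have dP s : cs_set S s -> d <= rnorm (x - s) ^+ 2.
  by move=> Ss; apply: (ge_inf lbD); exists s.
(* By the parallelogram law an excess of e^2 / 4 gives diameter at most e: the squared distance of
   two such points is at most 4 (d + e^2 / 4) - 4 d. *)
pose P (e : R) := [set s | cs_set S s /\ rnorm (x - s) ^+ 2 <= d + e ^+ 2 / 4].
have [p pP] : exists p, forall (e : R) s, 0 < e -> P e s -> rnorm (s - p) <= e.
  apply: nested_sets_limit.
  - move=> e e0; have e20 : 0 < e ^+ 2 / 4 by rewrite divr_gt0 ?exprn_gt0.
    have [_ [s Ss <-] sd] := inf_adherent e20 (conj D0 lbD).
    by exists s; split => //; exact: ltW.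
  - move=> e e' e0 ee' s [Ss sd]; split=> //; apply: le_trans sd _.
    by rewrite lerD2l ler_pM2r ?invr_gt0 // lerXn2r ?nnegrE // ltW // (lt_le_trans e0).
  move=> e s t e0 [Ss sd] [St td].
  have half2 : 2^-1%:C%C + 2^-1%:C%C = 1 :> R[i] by rewrite -rmorphD /=; congr (_%:C)%C; field.
  have /dP := csubspaceZ (2^-1%:C)%C (csubspaceD Ss St).
  have -> : x - 2^-1%:C%C *: (s + t) = 2^-1%:C%C *: ((x - s) + (x - t)).
    by rewrite addrACA -opprD scalerBr (scalerDr _ x x) -scalerDl half2 scale1r.
  rewrite rnormZr exprMn real_normK ?num_real // rnormD_sqr => md.
  have -> : s - t = (x - t) - (x - s) by rewrite opprB [RHS]addrC addrA subrK.
  apply: ler_of_sqr; first exact: ltW.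
  rewrite rnormB_sqr (rinnerC (x - t)).
  lra.
have SPe e : 0 < e -> exists2 s, cs_set S s & P e s /\ rnorm (s - p) <= e.
  move=> e0; have e20 : 0 < e ^+ 2 / 4 by rewrite divr_gt0 ?exprn_gt0.
  have [_ [s Ss <-] sd] := inf_adherent e20 (conj D0 lbD).
  have Pes : P e s by split=> //; exact: ltW.
  by exists s => //; split => //; exact: pP.
have Sp : cs_set S p.
  apply/csubspace_closure/closureP => e e0.
  have e20 : 0 < e / 2 by lra.
  have [s Ss [_ sp]] := SPe _ e20; exists s => //.
  by rewrite rnormBC; lra.
exists p => // s0 Ss0.
have pmin s : cs_set S s -> rnorm (x - p) <= rnorm (x - s).
  move=> Ss; apply/ler_addgt0Pr => e e0.
  have e20 : 0 < e / 2 by lra.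
  have [t St [[_ td] tp]] := SPe _ e20.
  have := rnormD (x - t) (t - p); rewrite addrA subrK => /le_trans; apply.
  rewrite [e in leRHS](splitr e) addrA; apply: lerD => //.
  apply: ler_of_sqr; first by rewrite addr_ge0 ?rnorm_ge0 // ltW.
  have := dP _ Ss; have := rnorm_ge0 (x - s); nra.
(* Moving p to p + t s with t real does not decrease the distance to x, so the term linear in t
   vanishes; applying this to i s as well yields the complex inner product. *)
have ortho s : cs_set S s -> rinner (x - p) s = 0.
  move=> Ss; apply: (@quadratic_ge0_linear0 _ (rnorm s ^+ 2)); first exact: sqr_ge0.
  move=> t; have := pmin _ (csubspaceD Sp (csubspaceZ (t%:C)%C Ss)).
  rewrite -(@ler_pXn2r _ 2) ?nnegrE ?rnorm_ge0 // opprD addrA [leRHS]rnormB_sqr.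
  rewrite rinnerZr rnormZr exprMn real_normK ?num_real //; nra.
by apply: rinner_inner0; apply: ortho => //; exact: csubspaceZ.
Qed.

Lemma rbounded (H1 H2 : hilbertType R) (f : H1 -> H2) (M : R) :
  (forall x, rnorm (f x) <= M * rnorm x) ->
  exists M : R[i], forall x, `|f x| <= M * `|x|.
Proof. by move=> fM; exists (M%:C)%C => x; rewrite !rnormE -rmorphM lecR. Qed.

Lemma bop_rbound (H1 H2 : hilbertType R) (A : 'L(H1, H2)) :
  exists2 M : R, 0 <= M & forall x, rnorm (A x) <= M * rnorm x.
Proof.
have [M AM] := bop_bounded A; exists (cmod M) => [|x].
  by rewrite -ler0c -cmodE.
have [->|x0] := eqVneq x 0; first by rewrite raddf0 !rnorm0 mulr0.
rewrite -lecR rmorphM /= -!rnormE -cmodE (le_trans (AM x)) // ler_wpM2r //.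
have M0 : 0 <= M.
  by rewrite -(pmulr_lge0 _ (x := `|x|)) ?normr_gt0 // (le_trans _ (AM x)).
by rewrite ger0_norm.
Qed.

Lemma riesz H (f : {scalar H}) (M : R) :
  (forall x, cmod (f x) <= M * rnorm x) -> exists v, forall x, f x = '[x, v].
Proof.
move=> fM.
have Ksub : submod_closed [in [set x | f x = 0]].
  split=> [|a x y /set_mem /= fx /set_mem /= fy]; apply/mem_set => /=.
    by rewrite linear0.
  by rewrite linearP fx fy mulr0 addr0.
have Kcl : closed [set x | f x = 0].
  move=> x /closureP clx /=.
  have M0 : 0 < `|M| + 1 by rewrite ltr_wpDl.
  have f0 : cmod (f x) <= 0.
    apply/ler_addgt0Pr => e e0; rewrite add0r.
    have [|y /= fy xy] := clx (e / (`|M| + 1)); first by rewrite divr_gt0.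
    have := fM (x - y); rewrite linearB /= fy subr0 => /le_trans; apply.
    move: xy; rewrite ltr_pdivlMr // => /ltW; apply: le_trans.
    by rewrite mulrC ler_wpM2l ?rnorm_ge0 // (le_trans (ler_norm M)) // lerDl.
  by apply/eqP; rewrite -normr_le0 cmodE lecR.
pose K := Csubspace Ksub Kcl.
have [[u fu]|f0] := pselect (exists u, f u != 0); last first.
  exists 0 => x; rewrite inner0r; apply: contrapT => /eqP fx.
  by apply: f0; exists x.
have [p Kp up] := orthogonal_projection K u.
pose z := u - p.
have fz : f z != 0 by rewrite /z linearB /= (_ : f p = 0) ?subr0.
have z0 : z != 0 by apply: contra_neq fz => ->; rewrite linear0.
have zz : '[z, z] != 0 by apply: contra_neq z0 => /inner_self0.
(* The vector z spans the orthogonal complement of the kernel, and f z = '[z, v] fixes the scalar,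
   conjugated because it sits in the second argument. *)
exists (((f z) / '[z, z])^* *: z) => x.
have Kx : cs_set K (x - (f x / f z) *: z) by rewrite /= linearB linearZ /= divfK // subrr.
have /up := Kx; rewrite -/z innerC => /(congr1 (@Num.conj _)).
rewrite conjCK conjC0 innerBl innerZl => /subr0_eq xz.
rewrite innerZr conjCK xz; field.
by rewrite fz.
Qed.

End Projection.

(** * Adjoints and projections *)

Section Operators.
Context {R : realType}.
Implicit Types H : hilbertType R.

Lemma bop_exists H1 H2 (f : H1 -> H2) (M : R) : linear f ->
  (forall x, rnorm (f x) <= M * rnorm x) -> exists B : 'L(H1, H2), B =1 f.
Proof. by move=> lf fM; exists (Bop lf (rbounded fM)). Qed.

(** Riesz representation of x |-> '[A x, z] gives the candidate b pointwise; its bound comes from |b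
    u|^2 = '[A (b u), u]. *)
Lemma adjointP H1 H2 (A : 'L(H1, H2)) x y : '[A x, y] = '[x, adjoint A y].
Proof.
have [M M0 AM] := bop_rbound A.
have bP z : exists v, forall x, '[A x, z] = '[x, v].
  pose f x := '[A x, z].
  have lf : linear_for *%R f by move=> a u v; rewrite /f linearP innerDl innerZl.
  pose F : {scalar H1} := HB.pack f (GRing.isLinear.Build _ _ _ _ f lf).
  apply: (riesz (f := F) (M := M * rnorm z)) => u.
  apply: le_trans (rnorm_CauchySchwarz _ _) _.
  by rewrite mulrAC ler_wpM2r // rnorm_ge0.
have [b bE] := choice bP.
suff [B BE] : exists B : 'L(H2, H1), B =1 b.
  have aP : exists B : 'L(H2, H1), forall x y, '[A x, y] = '[x, B y].
    by exists B => u v; rewrite bE BE.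
  by rewrite /adjoint; move: x y; exact: (xgetPex 0 aP).
apply: (@bop_exists _ _ _ M) => [a u v|u].
  by apply: inner_injr => z; rewrite -bE !innerDr !innerZr !bE.
have [->|bu0] := eqVneq (b u) 0; first by rewrite rnorm0 mulr_ge0 ?rnorm_ge0.
rewrite -(ler_pM2r (rnorm_gt0 bu0)) -expr2 rnorm_sqr {1}/rinner -bE -/(rinner _ _).
apply: le_trans (ler_norm _) _; apply: le_trans (ler_rinner _ _) _.
by rewrite mulrAC ler_wpM2r ?rnorm_ge0.
Qed.

Lemma adjointPr H1 H2 (A : 'L(H1, H2)) x y : '[adjoint A y, x] = '[y, A x].
Proof. by rewrite innerC -adjointP -innerC. Qed.

Lemma adjoint_eq H1 H2 (A : 'L(H1, H2)) (B : 'L(H2, H1)) :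
  (forall x y, '[A x, y] = '[x, B y]) -> adjoint A = B.
Proof.
by move=> AB; apply: bopP => y; apply: inner_inj => x; rewrite innerC -adjointP AB -innerC.
Qed.

Lemma adjointK H1 H2 (A : 'L(H1, H2)) : adjoint (adjoint A) = A.
Proof. by apply: adjoint_eq => x y; rewrite adjointPr. Qed.

Lemma adjoint_comp H1 H2 H3 (B : 'L(H2, H3)) (A : 'L(H1, H2)) :
  adjoint (B \bo A) = adjoint A \bo adjoint B.
Proof. by apply: adjoint_eq => x y /=; rewrite !adjointP. Qed.

Lemma adjointB H1 H2 (A B : 'L(H1, H2)) : adjoint (A - B) = adjoint A - adjoint B.
Proof. by apply: adjoint_eq => x y /=; rewrite innerBl innerBr !adjointP. Qed.

Lemma projection_unique H (S : csubspace H) (x p q : H) :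
  cs_set S p -> cs_set S q ->
  (forall s, cs_set S s -> '[x - p, s] = 0) ->
  (forall s, cs_set S s -> '[x - q, s] = 0) -> p = q.
Proof.
move=> Sp Sq xp xq; apply/subr0_eq/inner_self0.
have {1}-> : p - q = (x - q) - (x - p) by rewrite opprB [RHS]addrC addrA subrK.
rewrite innerBl.
by rewrite xp ?xq ?subrr //; exact: csubspaceB.
Qed.

Lemma cs_val_set H (S : csubspace H) (s : S) : cs_set S (cs_val s).
Proof. exact/set_mem/(valP s). Qed.

Lemma cs_projP H (S : csubspace H) x s :
  cs_set S s -> '[x - cs_val (cs_proj S x), s] = 0.
Proof.
have sP y : exists p : S, forall t, cs_set S t -> '[y - cs_val p, t] = 0.
  by have [p Sp yp] := orthogonal_projection S y; exists (CsElt (mem_set Sp)).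
have [p pP] := choice sP.
suff [P PE] : exists P : 'L(H, S), P =1 p.
  have eP : exists P : 'L(H, S), forall (x : H) (s : S), '[x - cs_incl S (P x), cs_incl S s] = 0.
    by exists P => u v; rewrite PE; apply: pP; exact: cs_val_set.
  by move=> Ss; exact: (xgetPex 0 eP x (CsElt (mem_set Ss))).
apply: (@bop_exists _ _ _ 1) => [a u v|u].
  apply: val_inj; apply: (projection_unique (S := S) (x := a *: u + v)).
  - exact: cs_val_set.
  - exact: cs_val_set.
  - exact: pP.
  move=> t St; rewrite [val _](bop_linear (cs_incl S)) /= opprD addrACA -scalerBr innerDl innerZl.
  by rewrite !pP // mulr0 addr0.
rewrite mul1r; apply: ler_of_sqr; first exact: rnorm_ge0.
rewrite -[X in _ <= rnorm X ^+ 2](subrK (cs_val (p u))) rnormD_sqr.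
rewrite {1}/rinner pP; last exact: cs_val_set.
by rewrite mulr0 addr0 lerDr sqr_ge0.
Qed.

Lemma cs_proj_eq H (S : csubspace H) x p : cs_set S p ->
  (forall s, cs_set S s -> '[x - p, s] = 0) -> cs_val (cs_proj S x) = p.
Proof.
move=> Sp xp; apply: projection_unique xp => //; first exact: cs_val_set.
by move=> s; exact: cs_projP.
Qed.

Lemma closure_range_submod H1 H2 (X : 'L(H1, H2)) :
  submod_closed [in closure (range X)].
Proof.
split=> [|a u v /set_mem /closureP Ku /set_mem /closureP Kv]; apply/mem_set.
  by apply: subset_closure; exists 0 => //; exact: raddf0.
apply/closureP => e e0.
have c0 : 0 < cmod a + 1 by rewrite ltr_wpDl // -ler0c -cmodE.
have d0 : 0 < e / (cmod a + 1) by rewrite divr_gt0.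
have [_ [x _ <-] ux] := Ku _ d0; have [_ [y _ <-] vy] := Kv _ d0.
exists (X (a *: x + y)); first by exists (a *: x + y).
rewrite bop_linear opprD addrACA -scalerBr; apply: le_lt_trans (rnormD _ _) _.
rewrite rnormZ -[ltRHS](divfK (lt0r_neq0 c0)).
have a0 : 0 <= cmod a by rewrite -ler0c -cmodE.
have := rnorm_ge0 (u - X x); nra.
Qed.

Definition closed_range H1 H2 (X : 'L(H1, H2)) : csubspace H2 :=
  Csubspace (closure_range_submod X) (@closed_closure _ _).

(** The bound makes X x |-> Y x well defined and bounded on the range of X; U extends it by
    continuity to the closure and by 0 to the orthogonal complement. Douglas' lemma and the polar
    decomposition both rest on this. *)
Lemma factor_through_range H1 H2 H3 (X : 'L(H1, H3)) (Y : 'L(H1, H2)) (c : R) :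
  (forall x, rnorm (Y x) <= c * rnorm (X x)) ->
  exists2 U : 'L(H3, H2), U \bo X = Y &
    forall z, (forall x, '[X x, z] = 0) -> U z = 0.
Proof.
move=> Yc.
pose C := `|c| + 1.
have C0 : 0 < C by rewrite ltr_wpDl.
have YC x : rnorm (Y x) <= C * rnorm (X x).
  by apply: le_trans (Yc x) _; rewrite ler_wpM2r ?rnorm_ge0 // (le_trans (ler_norm c)) // lerDl.
(* The pair (p, w) lies in the closure of {(X x, Y x)}. This closed linear relation is a graph by
   [Rel_bound], so linearity and boundedness of U need no choice of approximating sequences. *)
pose Rel p w := forall e : R, 0 < e ->
  exists x, rnorm (X x - p) <= e /\ rnorm (Y x - w) <= e.
have RelP a p w p' w' : Rel p w -> Rel p' w' -> Rel (a *: p + p') (a *: w + w').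
  move=> pw pw' e e0.
  have a0 : 0 <= cmod a by rewrite -ler0c -cmodE.
  have c0 : 0 < cmod a + 1 by rewrite ltr_wpDl.
  have d0 : 0 < e / (cmod a + 1) by rewrite divr_gt0.
  have [x [px wx]] := pw _ d0; have [y [py wy]] := pw' _ d0.
  exists (a *: x + y); rewrite !bop_linear.
  have eE : e / (cmod a + 1) * (cmod a + 1) = e by rewrite divfK // gt_eqF.
  split; rewrite opprD addrACA -scalerBr; apply: le_trans (rnormD _ _) _;
    rewrite rnormZ; nra.
have Rel_bound p w : Rel p w -> rnorm w <= C * rnorm p.
  move=> pw; apply/ler_addgt0Pr => e e0.
  have d0 : 0 < e / (C + 1) by rewrite divr_gt0 // addr_gt0.
  have [x [px wx]] := pw _ d0.
  have := rnormB (Y x) (Y x - w); rewrite subKr => /le_trans; apply.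
  have /le_trans := lerD (YC x) wx; apply.
  have : rnorm (X x) <= rnorm (X x - p) + rnorm p.
    by rewrite -{1}(subrK p (X x)); exact: rnormD.
  have eE : e / (C + 1) * (C + 1) = e by rewrite divfK // gt_eqF // addr_gt0.
  nra.
have Rel_uniq p w w' : Rel p w -> Rel p w' -> w = w'.
  move=> pw /(RelP (-1) _ _ _ _ pw) /Rel_bound.
  rewrite !scaleN1r !addNr rnorm0 mulr0 => ww'.
  by apply/esym/subr0_eq/rnorm_eq0/le_anti; rewrite rnorm_ge0 addrC ww'.
pose K := closed_range X.
have RelE p : cs_set K p -> exists w, Rel p w.
  move=> /closureP Kp.
  pose P (e : R) := [set Y x | x in [set x | C * rnorm (X x - p) <= e / 2]].
  have P0 (e : R) : 0 < e -> exists2 x, rnorm (X x - p) <= e & P e (Y x).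
    move=> e0; have m0 : 0 < Num.min e (e / 2 / C) by rewrite lt_min e0 !divr_gt0.
    have [_ [x _ <-]] := Kp _ m0; rewrite rnormBC lt_min => /andP [xe xC].
    exists x; first exact: ltW.
    by exists x => //=; rewrite mulrC -ler_pdivlMr // ltW.
  have [w wP] : exists w, forall (e : R) s, 0 < e -> P e s -> rnorm (s - w) <= e.
    apply: nested_sets_limit => [e /P0 [x _ ?]|e e' e0 ee' _ [x /= xe <-]|].
    - by exists (Y x).
    - by exists x => //=; lra.
    move=> e _ _ e0 [x /= xe <-] [y /= ye <-]; rewrite -linearB.
    apply: le_trans (YC _) _; rewrite linearB /=.
    have := rnormB (X x - p) (X y - p); rewrite opprB addrA addrNK; nra.
  by exists w => e e0; have [x xp Px] := P0 _ e0; exists x; split => //; exact: wP.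
have [u uP] := choice (fun z => RelE _ (cs_val_set (cs_proj K z))).
have [M M0 projM] := bop_rbound (cs_proj K).
have [U UE] : exists U : 'L(H3, H2), U =1 u.
  apply: (@bop_exists _ _ _ (C * M)) => [a y z|z].
    apply: Rel_uniq (uP _) _; rewrite bop_linear [cs_val _](bop_linear (cs_incl K)).
    exact (RelP a _ _ _ _ (uP y) (uP z)).
  apply: le_trans (Rel_bound _ _ (uP z)) _.
  by rewrite -mulrA; apply: ler_wpM2l; [exact: ltW|exact: projM].
exists U => [|z zX].
  apply: bopP => x /=; rewrite UE; apply: Rel_uniq (uP _) _ => e e0; exists x.
  have Kx : cs_set K (X x) by apply: subset_closure; exists x.
  have -> : cs_val (cs_proj K (X x)) = X x.
    by apply: cs_proj_eq => // t _; rewrite subrr inner0l.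
  by rewrite !subrr !rnorm0; split; exact: ltW.
rewrite UE; apply/rnorm_eq0/le_anti; rewrite rnorm_ge0 andbT.
have := Rel_bound _ _ (uP z); rewrite (@cs_proj_eq _ _ _ 0) ?rnorm0 ?mulr0 //.
  exact: csubspace0.
move=> s Ks; rewrite subr0 innerC.
(* As [orthoc [set z]] is closed and contains the range of X, it contains the closure; hence the
   projection of z onto it is 0. *)
have /(_ z erefl) -> : cs_set (orthoc [set z]) s; last by rewrite conjC0.
apply/csubspace_closure; apply: closure_subset Ks => _ [x _ <-] /= _ ->.
exact: zX.
Qed.

End Operators.

(** * Uniform boundedness and Douglas' lemma *)

Section Douglas.
Context {R : realType}.
Implicit Types H : hilbertType R.

(* Gliding hump. *)
Lemma uniform_boundedness H (W : set H) :
  (forall x, exists M : R, forall w, W w -> cmod '[x, w] <= M) ->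
  exists M : R, forall w, W w -> rnorm w <= M.
Proof.
move=> Wx; apply: contrapT => noM.
have bigW (M : R) : exists2 w, W w & M < rnorm w.
  apply: contrapT => noW; apply: noM; exists M => w Ww.
  by rewrite leNgt; apply/negP => Mw; apply: noW; exists w.
(* After the n-th step, of length q n = 3^-n, the remaining steps have total length q n / 2. So at
   least half of the hump q n * rnorm (w n) survives in the limit, which exceeds n by the threshold
   2 n / q n below. *)
pose q n : R := (3 ^ n)%:R^-1.
have q0 n : 0 < q n by rewrite invr_gt0 ltr0n expn_gt0.
have qS n : q n = 3 * q n.+1.
  by rewrite /q expnS natrM invfM mulrA divff ?mul1r // pnatr_eq0.
have bigWn n : exists v, W v /\ 2 * n%:R / q n < rnorm v.
  by have [v Wv nv] := bigW (2 * n%:R / q n); exists v.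
have [w wP] := choice bigWn.
have w0 n : 0 < rnorm (w n).
  by apply: le_lt_trans (wP n).2; rewrite !mulr_ge0 ?invr_ge0 ?(ltW (q0 n)).
(* The sign agrees with that of the current pairing, so the hump adds up; at 0 it must be 1 and not
   0, or no hump would be added. *)
pose sgn (r : R) : R := if 0 <= r then 1 else -1.
pose a n x := sgn (rinner x (w n)) * q n / rnorm (w n).
pose fix u n : H := if n is m.+1 then u m + (a m (u m))%:C%C *: w m else 0.
have a_norm n x : `|a n x| * rnorm (w n) = q n.
  rewrite /a !normrM (gtr0_norm (q0 n)) normfV (gtr0_norm (w0 n)) divfK ?gt_eqF //.
  by rewrite /sgn; case: ifP; rewrite ?normrN normr1 mul1r.
have u_hump n : q n * rnorm (w n) <= `|rinner (u n.+1) (w n)|.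
  rewrite /= rinnerDl rinnerZl -rnorm_sqr.
  have -> : a n (u n) * rnorm (w n) ^+ 2 = sgn (rinner (u n) (w n)) * (q n * rnorm (w n)).
    rewrite /a; field; by rewrite gt_eqF ?w0.
  rewrite /sgn; case: ifP => [r0|/negbT]; last rewrite -ltNge => r0.
    rewrite mul1r ger0_norm ?lerDr // addr_ge0 // mulr_ge0 // ltW //.
  have qw : 0 <= q n * rnorm (w n) by rewrite mulr_ge0 // ltW.
  by rewrite ler0_norm; lra.
have u_cauchy n k : rnorm (u (n + k)%N - u n) <= 3 / 2 * (q n - q (n + k)%N).
  elim: k => [|k IHk]; first by rewrite addn0 !subrr rnorm0 mulr0.
  rewrite addnS /= addrAC; apply: le_trans (rnormD _ _) _.
  by rewrite rnormZr a_norm; have := qS (n + k)%N; lra.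
pose P (e : R) := [set u n | n in [set n | 3 / 2 * q n <= e]].
have [l lP] : exists l, forall (e : R) s, 0 < e -> P e s -> rnorm (s - l) <= e.
  apply: nested_sets_limit => [e e0|e e' e0 ee' _ [n /= ne <-]|].
  - pose n := Num.truncn (3 / 2 / e); exists (u n); exists n => //=.
    rewrite /q ler_pdivrMr ?ltr0n ?expn_gt0 // -ler_pdivrMl // mulrC.
    rewrite (le_trans (ltW (truncnS_gt _))) // ler_nat.
    exact: ltn_expl.
  - by exists n => //; exact: le_trans ee'.
  move=> e _ _ e0 [n /= ne <-] [m /= me <-].
  wlog nm : n m ne me / (n <= m)%N => [th|].
    have [nm|/ltnW mn] := leqP n m; first exact: th.
    by rewrite rnormBC; exact: th.
  rewrite rnormBC -(subnKC nm); apply: le_trans (u_cauchy _ _) _.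
  by have := q0 (n + (m - n))%N; lra.
have [M MP] := Wx l.
pose n := (Num.truncn M).+1.
have Mn : M < n%:R by exact: truncnS_gt.
have := MP _ (wP n).1; apply/negP; rewrite -ltNge (lt_le_trans Mn) //.
have lu : rnorm (u n.+1 - l) <= q n / 2.
  apply: lP; first by rewrite divr_gt0.
  by exists n.+1 => //=; rewrite (qS n); lra.
apply: le_trans _ (ler_normRe _); rewrite -/(rinner l (w n)).
have -> : rinner l (w n) = rinner (u n.+1) (w n) - rinner (u n.+1 - l) (w n).
  by rewrite !rinnerE; ring.
apply: le_trans _ (lerB_dist _ _).
have := ler_rinner (u n.+1 - l) (w n).
have := u_hump n; have := (wP n).2; rewrite ltr_pdivrMr //.
have := w0 n; nra.
Qed.

(** If Y x = X d, then '[x, Y* z] = '[d, X* z], so the vectors Y* z with |X* z| <= 1 are pointwise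
    bounded, hence bounded in norm; scaling z finishes. *)
Lemma range_inclusion_bound H1 H2 H3 (X : 'L(H2, H3)) (Y : 'L(H1, H3)) :
  range Y `<=` range X ->
  exists C : R, forall z, rnorm (adjoint Y z) <= C * rnorm (adjoint X z).
Proof.
move=> YX.
have [M MP] : exists M : R, forall w,
    [set adjoint Y z | z in [set z | rnorm (adjoint X z) <= 1]] w -> rnorm w <= M.
  apply: uniform_boundedness => x; have [d _ Xd] := YX (Y x) (imageT _ _).
  exists (rnorm d) => _ [z /= z1 <-].
  rewrite -adjointP -Xd adjointP; apply: le_trans (rnorm_CauchySchwarz _ _) _.
  by rewrite ler_piMr // rnorm_ge0.
have M0 : 0 <= M.
  rewrite -(rnorm0 H1); apply: MP; exists 0; rewrite /= ?raddf0 //.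
  by rewrite rnorm0.
exists M => z; apply/ler_addgt0Pr => e e0.
(* The extra term keeps the scaling factor positive when X* z = 0. *)
pose d := rnorm (adjoint X z) + e / (M + 1).
have M10 : 0 < M + 1 by lra.
have d0 : 0 < d by rewrite ltr_wpDl ?rnorm_ge0 // divr_gt0.
have eE : e / (M + 1) * (M + 1) = e by rewrite divfK // gt_eqF.
have /MP : [set adjoint Y z | z in [set z | rnorm (adjoint X z) <= 1]]
    (adjoint Y ((d^-1)%:C%C *: z)).
  exists ((d^-1)%:C%C *: z) => //=.
  rewrite linearZ /= rnormZr gtr0_norm ?invr_gt0 // ler_pdivrMl // mulr1 lerDl.
  by rewrite ltW // divr_gt0.
rewrite linearZ /= rnormZr gtr0_norm ?invr_gt0 // ler_pdivrMl // /d.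
have : 0 < e / (M + 1) by rewrite divr_gt0.
nra.
Qed.

Lemma douglas H1 H2 H3 (X : 'L(H2, H3)) (Y : 'L(H1, H3)) :
  range Y `<=` range X ->
  exists D : 'L(H1, H2), X \bo D = Y /\ range D `<=` cs_set (orthoc (Defs.kernel X)).
Proof.
move=> /range_inclusion_bound [C /factor_through_range [U UX U0]].
exists (adjoint U); split.
  apply: bopP => x; apply: inner_inj => z /=.
  by rewrite adjointP adjointPr -[U _]/((U \bo adjoint X) z) UX -adjointP.
move=> _ [x _ <-] /= k Xk; rewrite adjointPr U0 ?inner0r // => y.
by rewrite adjointPr Xk inner0r.
Qed.

Lemma reduced_solutionP H1 H2 H3 (X : 'L(H2, H3)) (Y : 'L(H1, H3)) :
  range Y `<=` range X ->
  X \bo reduced_solution X Y = Y /\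
  range (reduced_solution X Y) `<=` cs_set (orthoc (Defs.kernel X)).
Proof. by move=> /douglas; exact: xgetPex. Qed.

End Douglas.

(** * Positive square roots and polar decomposition *)

Section PositiveOperators.
Context {R : realType}.
Implicit Types H : hilbertType R.

Lemma bop_0 H1 H2 (A : 'L(H1, H2)) : A 0 = 0.
Proof. exact: linear0. Qed.

Lemma bopZ H1 H2 (A : 'L(H1, H2)) a x : A (a *: x) = a *: A x.
Proof. exact: linearZ. Qed.

Lemma bopD H1 H2 (A : 'L(H1, H2)) x y : A (x + y) = A x + A y.
Proof. exact: linearD. Qed.

Lemma bopB H1 H2 (A : 'L(H1, H2)) x y : A (x - y) = A x - A y.
Proof. exact: linearB. Qed.

(** Polarisation: the form s vanishes on the diagonal, so s x y = - s y x; replacing y by i y gives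
    s x y = s y x. *)
Lemma positive_selfadjoint H (T : 'L(H, H)) : positive_op T ->
  forall x y, '[T x, y] = '[x, T y].
Proof.
move=> Tpos x y; pose s u v := '[T u, v] - '[u, T v].
have s0 u : s u u = 0.
  by rewrite /s (innerC u) conj_Creal ?subrr // ger0_real.
have sD u v : s u v + s v u = 0.
  have := s0 (u + v); rewrite /s !bopD !innerDl !innerDr => <-.
  have := s0 u; have := s0 v; rewrite /s => /subr0_eq -> /subr0_eq ->; ring.
have := sD x ('i%C *: y); have := sD x y; rewrite /s !bopZ !innerZl !innerZr.
have -> : ('i%C : R[i])^* = - 'i%C by rewrite /Num.conj /=; congr (_ +i* _)%C; rewrite oppr0.
set a := '[T x, y]; set b := '[x, T y]; set c := '[T y, x]; set d := '[y, T x].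
move=> /eqP; rewrite addr_eq0 => /eqP ab.
have -> : - 'i%C * a - - 'i%C * b + ('i%C * c - 'i%C * d) = - (2 * 'i%C) * (a - b) :> R[i].
  have -> : c = d - (a - b) by rewrite ab opprK addrC subrK.
  ring.
move=> /eqP; rewrite mulf_eq0 oppr_eq0 mulf_eq0 pnatr_eq0 /=.
have -> : ('i%C == 0 :> R[i]) = false by rewrite eq_complex /= oner_eq0 andbF.
by rewrite /= subr_eq0 => /eqP.
Qed.

Lemma positive_opP H (T : 'L(H, H)) :
  (forall x y, '[T x, y] = '[x, T y]) -> (forall x, 0 <= rinner (T x) x) ->
  positive_op T.
Proof.
move=> Tsa Tpos x; have := innerC (T x) x; rewrite -Tsa.
have := Tpos x; rewrite /rinner; case: '[T x, x] => a b /= a0 [/eqP].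
by rewrite -subr_eq0 opprK -mulr2n mulrn_eq0 /= => /eqP ->; rewrite lecE /= eqxx.
Qed.

Lemma positive_rinner_ge0 H (T : 'L(H, H)) x : positive_op T -> 0 <= rinner (T x) x.
Proof. by move=> /(_ x); rewrite lecE => /andP []. Qed.

(** Positivity of T at x - T x / M gives '[T x, x] >= |T x|^2 / M, which outweighs the quadratic
    term of the expanded square. *)
Lemma positive_contraction H (T : 'L(H, H)) (M : R) x : positive_op T -> 0 < M ->
  (forall x, rnorm (T x) <= M * rnorm x) ->
  rnorm (x - (M^-1)%:C%C *: T x) <= rnorm x.
Proof.
move=> Tpos M0 TM; apply: ler_of_sqr; first exact: rnorm_ge0.
have sq : rinner x (T (T x)) = rnorm (T x) ^+ 2.
  by rewrite /rinner -positive_selfadjoint // -/(rinner _ _) -rnorm_sqr.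
have := positive_rinner_ge0 (x - (M^-1)%:C%C *: T x) Tpos.
rewrite bopB bopZ !rinnerE (rinnerC (T (T x)) x) sq.
have := ler_rinner (T (T x)) (T x); have := TM (T x).
rewrite rnormB_sqr rinnerZr rnormZr exprMn real_normK ?num_real //.
rewrite (rinnerC x) -(rnorm_sqr (T x)).
have := rnorm_ge0 (T x); set n := rnorm (T x); set a := rinner (T x) x.
set k := rnorm _; set j := rinner _ _ => n0 kM jk.
have j' : j <= M * n ^+ 2.
  by rewrite (le_trans (ler_norm _)) // (le_trans jk) // expr2 mulrA ler_wpM2r.
have M'0 : 0 < M^-1 by rewrite invr_gt0.
have MM : M * M^-1 = 1 by rewrite divff ?gt_eqF.
have j'' : M^-1 * j <= n ^+ 2 by rewrite ler_pdivrMl.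
nra.
Qed.

Definition tends_to H (u : nat -> H) (l : H) :=
  forall e : R, 0 < e -> exists N, forall n, (N <= n)%N -> rnorm (u n - l) <= e.

Lemma tends_to_unique H (u : nat -> H) l l' : tends_to u l -> tends_to u l' -> l = l'.
Proof.
move=> ul ul'; apply/subr0_eq/rnorm_eq0/le_anti; rewrite rnorm_ge0 andbT.
apply/ler_addgt0Pr => e e0; rewrite add0r.
have e20 : 0 < e / 2 by lra.
have [N lN] := ul _ e20; have [N' lN'] := ul' _ e20; pose n := maxn N N'.
have -> : l - l' = (u n - l') - (u n - l) by rewrite opprB [RHS]addrC addrA subrK.
have := lN n (leq_maxl _ _); have := lN' n (leq_maxr _ _).
have := rnormB (u n - l') (u n - l); lra.
Qed.

Lemma tends_to_lin H (a : R[i]) (u v : nat -> H) l m : tends_to u l -> tends_to v m ->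
  tends_to (fun n => a *: u n + v n) (a *: l + m).
Proof.
move=> ul vm e e0.
have a0 : 0 <= cmod a by rewrite -ler0c -cmodE.
have a1 : 0 < cmod a + 1 by rewrite ltr_wpDl.
have eE : e / (cmod a + 1) * (cmod a + 1) = e by rewrite divfK // gt_eqF.
have d0 : 0 < e / (cmod a + 1) by rewrite divr_gt0.
have [N lN] := ul _ d0; have [N' lN'] := vm _ d0; exists (maxn N N') => n.
rewrite geq_max => /andP [/lN ln /lN' mn].
rewrite opprD addrACA -scalerBr; apply: le_trans (rnormD _ _) _.
rewrite rnormZ; nra.
Qed.

Lemma tends_to_cst H (l : H) : tends_to (fun=> l) l.
Proof. by move=> e e0; exists 0 => n _; rewrite subrr rnorm0 ltW. Qed.

Lemma tends_toS H (u : nat -> H) l : tends_to u l -> tends_to (fun n => u n.+1) l.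
Proof.
by move=> ul e /ul [N lN]; exists N => n Nn; apply: lN; exact: leq_trans (leqnSn n).
Qed.

Lemma tends_to_rnorm H (u : nat -> H) l (M : R) :
  tends_to u l -> (forall n, rnorm (u n) <= M) -> rnorm l <= M.
Proof.
move=> ul uM; apply/ler_addgt0Pr => e /ul [N /(_ N (leqnn N)) lN].
have := rnormB (u N) (u N - l); rewrite subKr; have := uM N; lra.
Qed.

Lemma tends_to_inner H (u v : nat -> H) x y l m : tends_to u l -> tends_to v m ->
  (forall n, '[u n, y] = '[x, v n]) -> '[l, y] = '[x, m].
Proof.
move=> ul vm uv; apply/subr0_eq/normr0_eq0; rewrite cmodE; apply: congr1.
apply: le_anti; rewrite -[0 <= _]ler0c -cmodE normr_ge0 andbT.
apply/ler_addgt0Pr => e e0; rewrite add0r.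
have c0 : 0 < rnorm x + rnorm y + 1 by rewrite ltr_wpDl ?addr_ge0 ?rnorm_ge0.
set c := _ + 1 in c0; have eE : e / c * c = e by rewrite divfK // gt_eqF.
have d0 : 0 < e / c by rewrite divr_gt0.
have [N lN] := ul _ d0; have [N' lN'] := vm _ d0; pose n := maxn N N'.
have -> : '[l, y] - '[x, m] = '[x, v n - m] - '[u n - l, y].
  by rewrite innerBl innerBr uv; ring.
have := rnorm_CauchySchwarz x (v n - m); have := rnorm_CauchySchwarz (u n - l) y.
have := lN n (leq_maxl _ _); have := lN' n (leq_maxr _ _).
have : cmod ('[x, v n - m] - '[u n - l, y]) <= cmod '[x, v n - m] + cmod '[u n - l, y].
  by rewrite -lecR rmorphD /= -!cmodE ler_normB.
have := rnorm_ge0 x; have := rnorm_ge0 y; rewrite /c in eE; nra.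
Qed.

(* With S = 1 - T / M, the limit Y of Y_(n+1) = (S + Y_n^2) / 2 solves
   (1 - Y)^2 = T / M; the scalar recursion y_n dominates its increments. *)
Lemma positive_sqrt H (T : 'L(H, H)) : positive_op T ->
  exists Q : 'L(H, H), positive_op Q /\ Q \bo Q = T.
Proof.
move=> Tpos; have [M' M'0 TM'] := bop_rbound T.
pose M := M' + 1; have M0 : 0 < M by rewrite /M; lra.
have TM x : rnorm (T x) <= M * rnorm x.
  by apply: le_trans (TM' x) _; rewrite ler_wpM2r ?rnorm_ge0 // lerDl.
pose S x := x - (M^-1)%:C%C *: T x.
have S1 x : rnorm (S x) <= rnorm x by exact: positive_contraction.
have Slin : linear S.
  by move=> a x y; rewrite /S bop_linear scalerDr opprD addrACA scalerBr !scalerA (mulrC a).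
have Ssa x y : '[S x, y] = '[x, S y].
  by rewrite /S innerBl innerBr innerZl innerZr conj_Creal ?positive_selfadjoint // complex_real eqxx.
pose h : R[i] := (2^-1)%:C%C.
pose Y n := iter n (fun f : H -> H => fun x => h *: (S x + f (f x))) (fun=> 0).
(* The same recursion with the contraction [S] replaced by 1; it increases and stays in [0, 1]. *)
pose y n := iter n (fun r : R => (1 + r ^+ 2) / 2) 0.
have Ylin n : linear (Y n).
  elim: n => [|n IHn] a x z /=; first by rewrite scaler0 addr0.
  rewrite -/(Y n) Slin !IHn addrACA -(scalerDr a) [LHS]scalerDr !scalerA.
  by rewrite (mulrC h).
have YB n x z : Y n (x - z) = Y n x - Y n z.
  by rewrite -[x - z]addrC -scaleN1r Ylin scaleN1r addrC.
have Ysa n x z : '[Y n x, z] = '[x, Y n z].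
  elim: n x z => [|n IHn] x z /=; first by rewrite inner0l inner0r.
  rewrite -/(Y n) innerZl innerZr innerDl innerDr Ssa !IHn conj_Creal //.
  by rewrite complex_real eqxx.
have y01 n : 0 <= y n <= 1.
  by elim: n => [|n /andP [y0 y1]] /=; rewrite -/(y _) ?lexx ?ler01 //; apply/andP; split; nra.
have hnorm (x : H) : rnorm (h *: x) = rnorm x / 2 by rewrite rnormZr gtr0_norm ?invr_gt0 // mulrC.
have Yy n x : rnorm (Y n x) <= y n * rnorm x.
  elim: n x => [|n IHn] x /=; rewrite -/(Y _) -/(y _); first by rewrite rnorm0 mul0r.
  rewrite hnorm; have := rnormD (S x) (Y n (Y n x)); have := S1 x.
  have := IHn (Y n x); have := IHn x; have /andP [y0 y1] := y01 n; nra.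
have Yinc n x : rnorm (Y n.+1 x - Y n x) <= (y n.+1 - y n) * rnorm x.
  elim: n x => [|n IHn] x.
    by rewrite /= subr0 addr0 hnorm; have := S1 x; lra.
  (* The difference of squares is split as Y_(n+1) (Y_(n+1) - Y_n) + (Y_(n+1) - Y_n) Y_n, which
     avoids commuting the operators. *)
  have -> : Y n.+2 x - Y n.+1 x
      = h *: (Y n.+1 (Y n.+1 x - Y n x) + (Y n.+1 (Y n x) - Y n (Y n x))).
    rewrite [Y n.+2 x]/= -[X in _ - X]/(h *: (S x + Y n (Y n x))) -/(Y n.+1).
    by rewrite -scalerBr YB addrA subrK opprD addrACA subrr add0r.
  rewrite hnorm; have := Yy n.+1 (Y n.+1 x - Y n x); have := IHn x; have := IHn (Y n x).
  have := rnormD (Y n.+1 (Y n.+1 x - Y n x)) (Y n.+1 (Y n x) - Y n (Y n x)).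
  have := Yy n x; have /andP [y0 y1] := y01 n; have /andP [z0 z1] := y01 n.+1.
  have -> : y n.+2 = (1 + y n.+1 ^+ 2) / 2 by [].
  have yE : y n.+1 = (1 + y n ^+ 2) / 2 by [].
  have yy : 0 <= y n.+1 - y n by rewrite yE; nra.
  move=> k1 k2 k3 k4 k5.
  have k6 : (y n.+1 - y n) * rnorm (Y n x) <= (y n.+1 - y n) * (y n * rnorm x).
    by rewrite ler_wpM2l.
  have k7 : y n.+1 * rnorm (Y n.+1 x - Y n x) <= y n.+1 * ((y n.+1 - y n) * rnorm x).
    by rewrite ler_wpM2l.
  have -> : ((1 + y n.+1 ^+ 2) / 2 - y n.+1) * rnorm x
     = (y n.+1 * ((y n.+1 - y n) * rnorm x) + (y n.+1 - y n) * (y n * rnorm x)) / 2.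
    by rewrite {2}yE; field.
  lra.
have ymono n m : (n <= m)%N -> y n <= y m.
  move=> /subnKC <-; elim: (m - n)%N => [|k IHk]; first by rewrite addn0.
  rewrite addnS; apply: le_trans IHk _.
  have -> : y (n + k).+1 = (1 + y (n + k)%N ^+ 2) / 2 by [].
  have := sqr_ge0 (y (n + k)%N - 1); nra.
have Ydiff n m x : (n <= m)%N -> rnorm (Y m x - Y n x) <= (y m - y n) * rnorm x.
  move=> /subnKC <-; elim: (m - n)%N => [|k IHk].
    by rewrite addn0 !subrr rnorm0 mul0r.
  rewrite addnS; have := Yinc (n + k)%N x.
  have := rnormD (Y (n + k).+1 x - Y (n + k)%N x) (Y (n + k)%N x - Y n x).
  rewrite addrA subrK; lra.
have ysup : has_sup (range y).
  by split; [exists (y 0); exists 0 | exists 1 => _ [n _ <-]; case/andP: (y01 n)].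
pose L := sup (range y).
have yL n : y n <= L by apply: (sup_upper_bound ysup); exists n.
have Yl_ex x : exists l, tends_to (Y^~ x) l.
  pose P (e : R) := [set Y n x | n in [set n | (L - y n) * rnorm x <= e]].
  have P0 (e : R) : 0 < e -> exists N, (L - y N) * rnorm x <= e.
    move=> e0; have x1 : 0 < rnorm x + 1 by rewrite ltr_wpDl ?rnorm_ge0.
    have d0 : 0 < e / (rnorm x + 1) by rewrite divr_gt0.
    have eE : e / (rnorm x + 1) * (rnorm x + 1) = e by rewrite divfK // gt_eqF.
    have [_ [N _ <-] LN] := sup_adherent d0 ysup; exists N.
    have := rnorm_ge0 x; rewrite -/L in LN; nra.
  have [l lP] : exists l, forall (e : R) s, 0 < e -> P e s -> rnorm (s - l) <= e.
    apply: nested_sets_limit => [e /P0 [N NP]|e e' e0 ee' _ [n /= ne <-]|].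
    - by exists (Y N x); exists N.
    - by exists n => //; exact: le_trans ee'.
    move=> e _ _ e0 [n /= ne <-] [m /= me <-].
    wlog nm : n m ne me / (n <= m)%N => [th|].
      have [nm|/ltnW mn] := leqP n m; first exact: th.
      by rewrite rnormBC; exact: th.
    rewrite rnormBC; apply: le_trans (Ydiff _ _ _ nm) _; apply: le_trans ne.
    by rewrite ler_wpM2r ?rnorm_ge0 // lerD2r.
  exists l => e e0; have [N NP] := P0 _ e0; exists N => n Nn; apply: lP => //.
  exists n => //=; apply: le_trans NP; rewrite ler_wpM2r ?rnorm_ge0 //.
  by rewrite lerB // ymono.
have [Z ZP] := choice Yl_ex.
have Zlin : linear Z.
  move=> a x z; apply: tends_to_unique (ZP _) _.
  rewrite (_ : Y^~ _ = fun n => a *: Y n x + Y n z); first exact: tends_to_lin.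
  by apply: funext => n; exact: Ylin.
have Z1 x : rnorm (Z x) <= rnorm x.
  apply: tends_to_rnorm (ZP x) _ => n; apply: le_trans (Yy n x) _.
  by rewrite ler_piMl ?rnorm_ge0 //; case/andP: (y01 n).
have Zsa x z : '[Z x, z] = '[x, Z z].
  by apply: tends_to_inner (ZP x) (ZP z) _ => n.
have ZZ x : Z (Z x) = Z x + Z x - S x.
  have ZZl : tends_to (fun n => Y n (Y n x)) (Z (Z x)).
    move=> e e0; have e20 : 0 < e / 2 by lra.
    have [N lN] := ZP x _ e20; have [N' lN'] := ZP (Z x) _ e20.
    exists (maxn N N') => n; rewrite geq_max => /andP [/lN ln /lN' mn].
    have -> : Y n (Y n x) - Z (Z x) = Y n (Y n x - Z x) + (Y n (Z x) - Z (Z x)).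
      by rewrite YB addrA subrK.
    apply: le_trans (rnormD _ _) _; have /andP [y0 y1] := y01 n.
    have := Yy n (Y n x - Z x); have := rnorm_ge0 (Y n x - Z x); nra.
  have ZE : Z x = h *: (Z (Z x) + S x).
    apply: tends_to_unique (tends_toS (ZP x)) _.
    rewrite (_ : (fun n => _) = fun n => h *: Y n (Y n x) + h *: S x).
      by rewrite (scalerDr h (Z (Z x))); exact: (tends_to_lin h ZZl (tends_to_cst (h *: S x))).
    by apply: funext => n; rewrite -scalerDr addrC.
  have hh : h + h = 1 by rewrite -rmorphD /=; congr (_%:C)%C; field.
  by rewrite [in RHS]ZE -scalerDl hh scale1r addrK.
(* From Z^2 = 2 Z - S follows (1 - Z)^2 = 1 - S = T / M, so the root is sqrt M (1 - Z), positive
   since Z is a self-adjoint contraction. *)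
pose r : R[i] := (Num.sqrt M)%:C%C.
have rr : r * r = M%:C%C by rewrite -rmorphM -expr2 sqr_sqrtr // ltW.
have [Q QE] : exists Q : 'L(H, H), Q =1 fun x => r *: (x - Z x).
  apply: (@bop_exists _ _ _ _ (Num.sqrt M * 2)) => [a x z|x].
    by rewrite Zlin opprD addrACA -scalerBr scalerDr !scalerA (mulrC r).
  rewrite rnormZr ger0_norm ?sqrtr_ge0 // -mulrA ler_wpM2l ?sqrtr_ge0 //.
  have := rnormB x (Z x); have := Z1 x; lra.
have ZB x z : Z (x - z) = Z x - Z z.
  by rewrite -[x - z]addrC -scaleN1r Zlin scaleN1r addrC.
exists Q; split; last first.
  apply: bopP => x /=; rewrite !QE.
  have -> : Z (r *: (x - Z x)) = r *: (Z x - Z (Z x)).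
    have Z0 : Z 0 = 0 by have := ZB 0 0; rewrite !subrr.
    by have := Zlin r (x - Z x) 0; rewrite Z0 !addr0 ZB.
  rewrite -scalerBr scalerA rr ZZ.
  have -> : x - Z x - (Z x - (Z x + Z x - S x)) = x - S x.
    by rewrite -addrA -opprD addrA subKr.
  by rewrite /S subKr scalerA -rmorphM /= divff ?gt_eqF // scale1r.
apply: positive_opP => [x z|x].
  rewrite !QE innerZl innerZr innerBl innerBr Zsa conj_Creal //.
  by rewrite complex_real eqxx.
rewrite QE rinnerZl mulr_ge0 ?sqrtr_ge0 // rinnerDl rinnerNl -rnorm_sqr.
have := ler_rinner (Z x) x; have := ler_norm (rinner (Z x) x).
have := Z1 x; have := rnorm_ge0 x; nra.
Qed.

Lemma sqrt_opP H (T : 'L(H, H)) : positive_op T ->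
  positive_op (sqrt_op T) /\ sqrt_op T \bo sqrt_op T = T.
Proof. by move=> /positive_sqrt; exact: xgetPex. Qed.

Lemma abs_opP H1 H2 (T : 'L(H1, H2)) :
  positive_op (abs_op T) /\ abs_op T \bo abs_op T = adjoint T \bo T.
Proof. by apply: sqrt_opP => x /=; rewrite adjointPr inner_rnorm ler0c sqr_ge0. Qed.

(* The defect Y = X Q1 - Q2 X satisfies Q2 Y = - Y Q1, hence
   Y (1 - t Q1)^n = (1 + t Q2)^n Y. For small t > 0 the left side is bounded
   in n, which forces Q2 Y = 0 = Y Q1, and then Y = 0. *)
Lemma positive_sqrt_intertwine H1 H2 (X : 'L(H1, H2)) (Q1 : 'L(H1, H1)) (Q2 : 'L(H2, H2)) :
  positive_op Q1 -> positive_op Q2 ->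
  X \bo (Q1 \bo Q1) = Q2 \bo Q2 \bo X -> X \bo Q1 = Q2 \bo X.
Proof.
move=> Q1pos Q2pos XQQ; pose Y := X \bo Q1 - Q2 \bo X.
have YE x : Y x = X (Q1 x) - Q2 (X x) by [].
have XQQx x : X (Q1 (Q1 x)) = Q2 (Q2 (X x)) by have := congr1 (@^~ x) (congr1 (@bop_fun _ _ _) XQQ).
have Q2Y x : Q2 (Y x) = - Y (Q1 x) by rewrite !YE bopB XQQx opprB.
have [M' M'0 QM'] := bop_rbound Q1.
pose M := M' + 1; have M0 : 0 < M by rewrite /M; lra.
have QM x : rnorm (Q1 x) <= M * rnorm x.
  by apply: le_trans (QM' x) _; rewrite ler_wpM2r ?rnorm_ge0 // lerDl.
pose t := M^-1; have t0 : 0 < t by rewrite invr_gt0.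
pose c (x : H1) := x - t%:C%C *: Q1 x; pose e (z : H2) := z + t%:C%C *: Q2 z.
have Yc x : Y (c x) = e (Y x).
  by rewrite /c /e bopB bopZ Q2Y scalerN.
have Ycn n x : Y (iter n c x) = iter n e (Y x).
  by elim: n => [//|n IHn]; rewrite !iterS Yc IHn.
have cn n x : rnorm (iter n c x) <= rnorm x.
  by elim: n => [//|n IHn] /=; apply: le_trans IHn; exact: positive_contraction.
have eD z : rnorm z ^+ 2 + t ^+ 2 * rnorm (Q2 z) ^+ 2 <= rnorm (e z) ^+ 2.
  rewrite /e rnormD_sqr rinnerZr rinnerC rnormZr exprMn real_normK ?num_real //.
  have := positive_rinner_ge0 z Q2pos; nra.
have Q2e n z : Q2 (iter n e z) = iter n e (Q2 z).
  by elim: n => [//|n IHn] /=; rewrite {1}/e bopD bopZ IHn.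
have e_ge n z : rnorm z ^+ 2 <= rnorm (iter n e z) ^+ 2.
  elim: n => [//|n IHn] /=; apply: le_trans IHn _; apply: le_trans (eD _).
  by rewrite lerDl mulr_ge0 ?sqr_ge0.
(* Q2 commutes with e and e does not shrink norms, so each iteration adds at least t^2 |Q2 z|^2 to
   the squared norm. *)
have en n z : n%:R * (t ^+ 2 * rnorm (Q2 z) ^+ 2) <= rnorm (iter n e z) ^+ 2.
  elim: n => [|n IHn] /=; first by rewrite mul0r sqr_ge0.
  apply: le_trans (eD _); rewrite -natr1 mulrDl mul1r lerD //.
  by rewrite ler_wpM2l ?sqr_ge0 // Q2e.
have Q2Y0 x : Q2 (Y x) = 0.
  have [K K0 YK] := bop_rbound Y.
  apply: contrapT => /eqP /rnorm_gt0 q0.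
  have a0 : 0 < t ^+ 2 * rnorm (Q2 (Y x)) ^+ 2 by rewrite mulr_gt0 ?exprn_gt0.
  pose b := (K * rnorm x) ^+ 2; set a := (X in 0 < X) in a0.
  have nb n : n%:R <= b / a.
    rewrite ler_pdivlMr //; apply: le_trans (en n (Y x)) _.
    rewrite -Ycn lerXn2r ?nnegrE ?mulr_ge0 ?rnorm_ge0 //.
    by apply: le_trans (YK _) _; rewrite ler_wpM2l.
  have := truncnS_gt (b / a); apply/negP; rewrite -leNgt; exact: nb.
have YQ1 x : Y (Q1 x) = 0 by rewrite -[LHS]opprK -Q2Y Q2Y0 oppr0.
(* It remains to see Y Y* = 0. In Y Y* = X Q1 Y* - Q2 X Y* the first term vanishes since Q1 Y* is
   the adjoint of Y Q1; the second is orthogonal to the range of Y since Q2 Y = 0. *)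
have Q1Ya z : Q1 (adjoint Y z) = 0.
  apply: inner_inj => x; rewrite inner0l positive_selfadjoint // adjointPr.
  by rewrite YQ1 inner0r.
have YYa z : Y (adjoint Y z) = 0.
  apply: inner_self0; rewrite {1}YE Q1Ya raddf0 sub0r -scaleN1r innerZl.
  by rewrite positive_selfadjoint // Q2Y0 inner0r mulr0.
have Ya z : adjoint Y z = 0.
  by apply: inner_self0; rewrite adjointPr YYa inner0r.
apply: bopP => x; apply/subr0_eq; rewrite -[LHS]/(Y x).
by apply: inner_inj => z; rewrite adjointP Ya inner0r inner0l.
Qed.

(** Since |T x| and | |T| x | agree, |T| x |-> T x is isometric. Extended by 0 off the closed range
    K of |T|, it has as kernel the orthogonal complement of K, which is the kernel of T. *)
Lemma polar_factorP H1 H2 (T : 'L(H1, H2)) :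
  Defs.kernel (polar_factor T) = Defs.kernel T /\ T = polar_factor T \bo abs_op T.
Proof.
suff : exists U : 'L(H1, H2),
    [/\ partial_isometry U, Defs.kernel U = Defs.kernel T & T = U \bo abs_op T].
  by move=> /(xgetPex 0) [].
have [Tpos TT] := abs_opP T; set A := abs_op T in Tpos TT *.
have nT x : rnorm (T x) = rnorm (A x).
  apply/eqP; rewrite -(@eqrXn2 _ 2) ?rnorm_ge0 // !rnorm_sqr /rinner.
  rewrite -(adjointPr T) -(positive_selfadjoint Tpos).
  by rewrite -[A (A x)]/((A \bo A) x) TT.
have [|U UA U0] := factor_through_range (X := A) (Y := T) (c := 1).
  by move=> x; rewrite mul1r nT.
have UAx x : U (A x) = T x by rewrite -[LHS]/((U \bo A) x) UA.
pose K := closed_range A; pose p x := cs_val (cs_proj K x).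
have Kp x : cs_set K (p x) by exact: cs_val_set.
have px x s : cs_set K s -> '[x - p x, s] = 0 by exact: cs_projP.
have KA x : cs_set K (A x) by apply: subset_closure; exists x.
have Up x : U x = U (p x).
  apply/subr0_eq; rewrite -bopB; apply: U0 => z.
  by rewrite innerC px // conjC0.
have Uiso x : cs_set K x -> rnorm (U x) = rnorm x.
  have [M M0 UM] := bop_rbound U.
  have M1 : 0 < M + 1 by lra.
  move=> /closureP Kx; apply: le_anti; apply/andP; split; apply/ler_addgt0Pr => e e0;
    (have d0 : 0 < e / (M + 1) by rewrite divr_gt0);
    (have eE : e / (M + 1) * (M + 1) = e by rewrite divfK // gt_eqF);
    have [_ [y _ <-] xy] := Kx _ d0;
    have := UM (x - A y); rewrite bopB UAx => Uxy.
  - have := rnormD (U x - T y) (T y); rewrite subrK nT.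
    have := rnormD (A y - x) x; rewrite subrK rnormBC; nra.
  have := rnormD (x - A y) (A y); rewrite subrK -nT.
  have := rnormD (T y - U x) (U x); rewrite subrK rnormBC; nra.
exists U; split; last by rewrite UA.
- move=> x xU; rewrite !rnormE; suff -> : x = p x by rewrite Uiso.
  have xpx : Defs.kernel U (x - p x) by rewrite /Defs.kernel /= bopB -Up subrr.
  apply/subr0_eq/inner_self0; rewrite innerBl (xU _ xpx) sub0r.
  by rewrite innerC px // conjC0 oppr0.
apply/seteqP; split=> x; rewrite /Defs.kernel /= => Tx0.
- have p0 : p x = 0 by apply/rnorm_eq0; rewrite -Uiso // -Up Tx0 rnorm0.
  apply/rnorm_eq0; rewrite nT.
  suff -> : A x = 0 by rewrite rnorm0.
  apply: inner_inj => z; rewrite positive_selfadjoint // inner0l.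
  by rewrite -[x]subr0 -p0 px.
apply: U0 => z; rewrite positive_selfadjoint //.
have -> : A x = 0 by apply/rnorm_eq0; rewrite -nT Tx0 rnorm0.
by rewrite inner0r.
Qed.

End PositiveOperators.

(** * Angles between ranges *)

Section MinusOrder.
Context {R : realType}.
Implicit Types H : hilbertType R.

Lemma dixmier_cosE H (M N : set H) (c : R) :
  (exists x y, [/\ M x, N y, `|x| = 1, `|y| = 1 & c%:C%C = `|'[x, y]|]) ->
  exists x y, [/\ M x, N y, rnorm x = 1, rnorm y = 1 & c = cmod '[x, y]].
Proof.
by move=> [x [y [Mx Ny x1 y1 cE]]]; exists x, y; split=> //; rewrite ?/rnorm ?x1 ?y1 // /cmod -cE.
Qed.

(** The case of no unit vectors, where [sup] is 0, is what [0 <= k] covers. *)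
Lemma dixmier_cos_le H (M N : set H) (k : R) : 0 <= k ->
  (forall x y, M x -> N y -> rnorm x = 1 -> rnorm y = 1 -> cmod '[x, y] <= k) ->
  dixmier_cos M N <= k.
Proof.
move=> k0 MNk; rewrite /dixmier_cos; set E := [set c | _].
have [->|E0] := eqVneq E set0; first by rewrite sup0.
apply: ge_sup; first exact/set0P.
by move=> _ /dixmier_cosE [x [y [Mx Ny x1 y1 ->]]]; exact: MNk.
Qed.

Lemma dixmier_cos_subset H (M M' N N' : set H) : M `<=` M' -> N `<=` N' ->
  dixmier_cos M' N' < 1 -> dixmier_cos M N < 1.
Proof.
move=> MM' NN'; rewrite /dixmier_cos; set E := [set c | _]; set E' := [set c | _].
have EE' : E' `<=` E by move=> c [x [y [Mx Ny x1 y1 cE]]]; exists x, y; split; auto.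
have [->|/set0P E0] := eqVneq E' set0; first by rewrite sup0.
apply: le_lt_trans; apply: ge_sup => // c /EE' Ec.
apply: ub_le_sup => //; exists 1 => d /dixmier_cosE [x [y [_ _ x1 y1 ->]]].
by apply: le_trans (rnorm_CauchySchwarz _ _) _; rewrite x1 y1 mulr1.
Qed.

Lemma closure_kernel H1 H2 (B : 'L(H1, H2)) (M : set H1) :
  (forall x, M x -> B x = 0) -> forall x, closure M x -> B x = 0.
Proof.
move=> BM x Mx; apply: inner_inj => z; rewrite inner0l adjointP.
have /(_ (adjoint B z)) : cs_set (orthoc [set adjoint B z]) x.
  apply/csubspace_closure; apply: closure_subset Mx => y My /= _ ->.
  by rewrite -adjointP BM // inner0l.
exact.
Qed.

(** For unit vectors with Q x = x, Q y = 0 and a = '[x, y], one has Q (x - a y) = x. If K bounds Q,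
    then 1 <= K^2 (1 - |a|^2), which keeps |a| away from 1. *)
Lemma idempotent_dixmier_cos H1 H2 (Q : 'L(H2, H2)) (A : 'L(H1, H2)) :
  Q \bo Q = Q ->
  dixmier_cos (closure (range (Q \bo A))) (closure (range (A - Q \bo A))) < 1.
Proof.
move=> QQ; have QQx x : Q (Q x) = Q x by rewrite -[LHS]/((Q \bo Q) x) QQ.
(* With the identity as an operator, the fixed vectors of Q form the kernel of Q - I, to which
   [closure_kernel] applies. *)
have [I IE] : exists I : 'L(H2, H2), I =1 id.
  by apply: (@bop_exists _ _ _ _ 1) => // x; rewrite mul1r.
have QM x : closure (range (Q \bo A)) x -> Q x = x.
  move=> Mx; apply/subr0_eq; rewrite -[X in _ - X]IE -[LHS]/((Q - I) x).
  by apply: closure_kernel Mx => _ [y _ <-]; rewrite /= IE QQx subrr.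
have QN x : closure (range (A - Q \bo A)) x -> Q x = 0.
  by apply: closure_kernel => _ [y _ <-]; rewrite [X in Q X]/= bopB QQx subrr.
have [K' K'0 QK'] := bop_rbound Q; pose K := K' + 1.
have K1 : 1 <= K by rewrite /K; lra.
have QK x : rnorm (Q x) <= K * rnorm x.
  by apply: le_trans (QK' x) _; rewrite ler_wpM2r ?rnorm_ge0 // lerDl.
have K2 : 1 <= K ^+ 2 by rewrite exprn_ege1.
have i0 : 0 < (K ^+ 2)^-1 by rewrite invr_gt0; lra.
have i1 : (K ^+ 2)^-1 <= 1 by rewrite invf_le1 //; lra.
have iK : (K ^+ 2)^-1 * K ^+ 2 = 1 by rewrite mulVf // gt_eqF //; lra.
(* This rational bound replaces sqrt (1 - K^-2), as (1 - k / 2)^2 >= 1 - k. *)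
apply: (@le_lt_trans _ _ (1 - (K ^+ 2)^-1 / 2)); last lra.
apply: dixmier_cos_le => [|x y /QM Qx /QN Qy x1 y1]; first lra.
pose a := '[x, y]; rewrite -/a.
have Qz : Q (x - a *: y) = x by rewrite bopB bopZ Qx Qy scaler0 subr0.
have z2 : rnorm (x - a *: y) ^+ 2 = 1 - cmod a ^+ 2.
  rewrite rnormB_sqr x1 rnormZ y1 mulr1 /rinner innerZr -/a.
  have -> : complex.Re (a^* * a) = cmod a ^+ 2.
    by rewrite mulrC -normCK cmodE -rmorphXn.
  by ring.
apply: ler_of_sqr; first by lra.
have := QK (x - a *: y); rewrite Qz x1 => zK.
have : 1 <= K ^+ 2 * rnorm (x - a *: y) ^+ 2.
  by rewrite -exprMn exprn_ege1.
rewrite z2 => h; have : (K ^+ 2)^-1 <= 1 - cmod a ^+ 2.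
  by rewrite -[leLHS]mulr1 ler_pdivrMl //; lra.
nra.
Qed.

End MinusOrder.

(** * The shorted operator as an oblique compression *)

Section Blocks.
Context {R : realType}.
Implicit Types H : hilbertType R.

Lemma cs_proj_add H (S : csubspace H) x :
  cs_incl S (cs_proj S x) + cs_incl (cs_perp S) (cs_proj (cs_perp S) x) = x.
Proof.
rewrite addrC; apply/eqP; rewrite eq_sym -subr_eq; apply/eqP/esym; apply: cs_proj_eq.
  by move=> s; exact: cs_projP.
by move=> s sS; rewrite subKr innerC sS ?conjC0 //; exact: cs_val_set.
Qed.

Lemma cs_proj_incl H (S : csubspace H) s : cs_proj S (cs_incl S s) = s.
Proof.
apply: val_inj; apply: cs_proj_eq; first exact: cs_val_set.
by move=> t _; rewrite subrr inner0l.
Qed.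

Lemma cs_proj_ortho H (S : csubspace H) x : cs_set (cs_perp S) x -> cs_proj S x = 0.
Proof.
move=> xS; apply: val_inj; apply: cs_proj_eq; first exact: csubspace0.
by move=> s Ss; rewrite subr0 xS.
Qed.

Lemma adjoint_cs_incl H (S : csubspace H) : adjoint (cs_incl S) = cs_proj S.
Proof.
apply: adjoint_eq => s x; apply/esym/subr0_eq; rewrite cs_innerE -[val s]/(cs_incl S s).
have := cs_projP x (cs_val_set s); rewrite innerC => /(congr1 (@Num.conj _)).
rewrite conjCK conjC0 innerBr => /eqP; rewrite subr_eq0 => /eqP ->.
exact: subrr.
Qed.

Lemma adjoint_cs_proj H (S : csubspace H) : adjoint (cs_proj S) = cs_incl S.
Proof. by rewrite -adjoint_cs_incl adjointK. Qed.

(** Put P = |A22|^(1/2) and Q = |A22*|^(1/2), so that A22 = Q U P. Both F and U* Q G solve P X =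
    B12, so they differ by values in ker P, which lies in ker (Q U). The range of the reduced
    solution E is orthogonal to ker (Q U); hence '[E x, F y] = '[Q U E x, G y] = '[A21 x, G y]. *)
Lemma shorted_product H1 H2 H3 H4 (A22 : 'L(H1, H2)) (A21 : 'L(H3, H2))
    (B12 : 'L(H4, H1)) (G : 'L(H4, H2)) :
  range A21 `<=` range A22 -> adjoint A22 \bo G = B12 ->
  let U := polar_factor A22 in
  let E := reduced_solution (sqrt_op (abs_op (adjoint A22)) \bo U) A21 in
  let F := reduced_solution (sqrt_op (abs_op A22)) B12 in
  adjoint F \bo E = adjoint G \bo A21.
Proof.
move=> A21r AG U E F; rewrite {}/E {}/F.
have [absP absE] := abs_opP A22; have [absP' absE'] := abs_opP (adjoint A22).
have [Ppos PP] := sqrt_opP absP; have [Qpos QQ] := sqrt_opP absP'.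
have [kerU polar] := polar_factorP A22.
rewrite -/U in kerU polar.
set a := abs_op A22 in absP absE Ppos PP polar *.
set b := abs_op (adjoint A22) in absP' absE' Qpos QQ *.
set P := sqrt_op a in Ppos PP *; set Q := sqrt_op b in Qpos QQ *.
have PPx x : P (P x) = a x by rewrite -PP.
have Ux x : U (P (P x)) = A22 x by rewrite PPx [in RHS]polar.
have Aa : A22 \bo a = b \bo A22.
  apply: positive_sqrt_intertwine => //; rewrite absE absE' adjointK.
  exact: bopP.
have AP : A22 \bo P = Q \bo A22.
  by apply: positive_sqrt_intertwine => //; rewrite PP QQ.
have APx x : A22 (P x) = Q (A22 x) by rewrite -[LHS]/((A22 \bo P) x) AP.
(* The intertwining yields only Z P^2 = 0. One factor P is cancelled on the adjoint side, where P^2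
   and P have the same kernel; then Z P = 0 reads Q U P = U P^2 = A22. *)
pose Z := Q \bo U - U \bo P.
have ZE x : Z x = Q (U x) - U (P x) by [].
have ZPP x : Z (P (P x)) = 0 by rewrite ZE Ux -APx -Ux subrr.
have PZ z : P (adjoint Z z) = 0.
  have PPZ : P (P (adjoint Z z)) = 0.
    apply: inner_inj => x; rewrite inner0l !(positive_selfadjoint Ppos) adjointPr.
    by rewrite ZPP inner0r.
  by apply: inner_self0; rewrite (positive_selfadjoint Ppos) PPZ inner0r.
have ZP x : Z (P x) = 0.
  apply: inner_inj => z.
  by rewrite adjointP (positive_selfadjoint Ppos) PZ inner0r inner0l.
have QUP x : Q (U (P x)) = A22 x.
  by apply/subr0_eq; rewrite -Ux -ZE.
have [EE Er] : (Q \bo U) \bo reduced_solution (Q \bo U) A21 = A21 /\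
    range (reduced_solution (Q \bo U) A21) `<=` cs_set (orthoc (Defs.kernel (Q \bo U))).
  apply: reduced_solutionP => y /A21r [x _ <-].
  by exists (P x) => //=; rewrite QUP.
have [FE _] : P \bo reduced_solution P B12 = B12 /\
    range (reduced_solution P B12) `<=` cs_set (orthoc (Defs.kernel P)).
  apply: reduced_solutionP => _ [x _ <-]; rewrite -AG.
  exists (adjoint U (Q (G x))) => //=; apply: inner_inj => y.
  by rewrite (positive_selfadjoint Ppos) !adjointPr (positive_selfadjoint Qpos) QUP.
set E := reduced_solution _ A21 in EE Er *; set F := reduced_solution P B12 in FE *.
have kerPU x : P x = 0 -> U x = 0.
  move=> Px; suff : Defs.kernel U x by [].
  by rewrite kerU /Defs.kernel /= -Ux Px !bop_0.
apply: bopP => x; apply: inner_injr => y /=; rewrite -!adjointP.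
have -> : A21 x = Q (U (E x)) by rewrite -[in LHS]EE.
apply/subr0_eq; rewrite -(positive_selfadjoint Qpos) -(adjointPr U) -innerBl.
rewrite innerC (Er (E x)) ?conjC0 //.
rewrite /Defs.kernel /= kerPU ?bop_0 //.
have PF : P (F y) = B12 y by rewrite -FE.
rewrite bopB PF -AG; apply/eqP; rewrite subr_eq0; apply/eqP.
apply: inner_inj => z /=.
by rewrite (positive_selfadjoint Ppos) !adjointPr (positive_selfadjoint Qpos) QUP.
Qed.

Section Shorted.
Variables (H1 H2 : hilbertType R).
Implicit Types (S : csubspace H1) (T : csubspace H2) (A : 'L(H1, H2)).

(** Taking adjoints transposes the block matrix and exchanges S and T, so results about A relative
    to (S, T) transfer to its adjoint relative to (T, S). *)
Lemma adjoint_block12 S T A : adjoint (block12 S T A) = block21 T S (adjoint A).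
Proof.
rewrite /block12 /block21 !adjoint_comp adjoint_cs_incl adjoint_cs_proj.
exact: bopP.
Qed.

Lemma adjoint_block21 S T A : adjoint (block21 S T A) = block12 T S (adjoint A).
Proof.
rewrite /block12 /block21 !adjoint_comp adjoint_cs_incl adjoint_cs_proj.
exact: bopP.
Qed.

Lemma adjoint_block11 S T A : adjoint (block11 S T A) = block11 T S (adjoint A).
Proof.
rewrite /block11 !adjoint_comp adjoint_cs_incl adjoint_cs_proj.
exact: bopP.
Qed.

Lemma adjoint_block22 S T A : adjoint (block22 S T A) = block22 T S (adjoint A).
Proof.
rewrite /block22 !adjoint_comp adjoint_cs_incl adjoint_cs_proj.
exact: bopP.
Qed.

Lemma block_op11 S T (B : 'L(S, T)) :
  block_op B 0 0 0 = cs_incl T \bo B \bo cs_proj S.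
Proof.
apply: bopP => x; rewrite -[LHS]/(cs_incl T (B (cs_proj S x) + 0)
  + cs_incl (cs_perp T) (0 + 0)).
by rewrite !addr0.
Qed.

(* The oblique projection along cs_perp S onto the graph {s - D s | s in S}. *)
Lemma oblique_projection S T A (D : 'L(S, cs_perp S)) :
  block22 S T A \bo D = block21 S T A ->
  exists P : 'L(H1, H1), [/\ P \bo P = P,
    forall x, cs_set (cs_perp S) (P x - x) &
    A \bo P = block_op (block11 S T A - block12 S T A \bo D) 0 0 0].
Proof.
move=> AD; pose P := (cs_incl S - cs_incl (cs_perp S) \bo D) \bo cs_proj S.
have PE x : P x = cs_incl S (cs_proj S x) - cs_incl (cs_perp S) (D (cs_proj S x)) by [].
have pP x : cs_proj S (P x) = cs_proj S x.
  rewrite PE bopB cs_proj_incl [X in _ - X]cs_proj_ortho ?subr0 //.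
  exact: cs_val_set.
exists P; split.
- by apply: bopP => x; rewrite -[LHS]/(P (P x)) [LHS]PE pP.
- move=> x; rewrite PE -[X in _ - X](cs_proj_add S) opprD addrACA.
  rewrite subrr add0r -opprD -scaleN1r.
  apply: csubspaceZ; apply: csubspaceD; exact: cs_val_set.
rewrite block_op11; apply: bopP => x; set s := cs_proj S x.
rewrite -[LHS](cs_proj_add T) -[LHS]/(cs_incl T (cs_proj T (A (P x)))
   + cs_incl (cs_perp T) (cs_proj (cs_perp T) (A (P x)))).
have -> : cs_proj (cs_perp T) (A (P x)) = block21 S T A s - block22 S T A (D s).
  by rewrite PE !bopB.
rewrite -[block22 _ _ _ _]/((block22 S T A \bo D) s) AD subrr raddf0 addr0.
by rewrite PE !bopB.
Qed.

Lemma comp_eq_of_perp S (C : 'L(H1, H2)) (P : 'L(H1, H1)) :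
  range (adjoint C) `<=` cs_set S ->
  (forall x, cs_set (cs_perp S) (P x - x)) -> C \bo P = C.
Proof.
move=> CS PS; apply: bopP => x; apply/subr0_eq; rewrite /= -bopB.
apply: inner_inj => z; rewrite adjointP PS ?inner0l //; apply: CS.
by exists z.
Qed.

End Shorted.
End Blocks.

Theorem theorem4p15 (R : realType) (H1 H2 : hilbertType R)
    (S : csubspace H1) (T : csubspace H2) (A : 'L(H1, H2)) :
  complementable S T A ->
  minus_lower_set A S T (bilateral_shorted S T A) /\
  forall C : 'L(H1, H2), minus_lower_set A S T C ->
    minus_le C (bilateral_shorted S T A).
Proof.
move=> [A21r A12r].
have [D [AD _]] := douglas A21r; have [G [AG _]] := douglas A12r.
pose W := bilateral_shorted S T A; rewrite -/W.
have WE : W = block_op (block11 S T A - adjoint G \bo block21 S T A) 0 0 0.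
  by rewrite /W /bilateral_shorted (shorted_product A21r AG).
(* Both sides equal G* A22 D, by A12 = G* A22 and A22 D = A21. *)
have DG : block12 S T A \bo D = adjoint G \bo block21 S T A.
  rewrite -[block12 S T A]adjointK -AG adjoint_comp adjointK -AD; exact: bopP.
have [P [PP PS AP]] := oblique_projection AD.
(* In terms of the blocks of [adjoint A] relative to (T, S), the equation for G has the form of the
   one for D, so the same construction yields P', whose adjoint is Q. *)
have := AG; rewrite adjoint_block22 adjoint_block12.
move=> /oblique_projection [P' [PP' PT AP']].
have {AP}AP : A \bo P = W by rewrite AP WE DG.
have {AP'}AP' : adjoint A \bo P' = adjoint W.
  rewrite AP' WE !block_op11 !adjoint_comp adjoint_cs_incl adjoint_cs_proj.
  rewrite adjointB adjoint_comp adjointK adjoint_block11 adjoint_block21.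
  exact: bopP.
have WQ : W = adjoint P' \bo A by rewrite -[W]adjointK -AP' adjoint_comp adjointK.
have WQ' : adjoint W = adjoint P \bo adjoint A by rewrite -AP adjoint_comp.
split.
  split.
  - split.
      by rewrite WQ; apply: idempotent_dixmier_cos; rewrite -adjoint_comp PP'.
    by rewrite WQ'; apply: idempotent_dixmier_cos; rewrite -adjoint_comp PP.
  - by move=> _ [x _ <-]; rewrite WE block_op11; exact: cs_val_set.
  move=> _ [x _ <-]; rewrite WE block_op11 !adjoint_comp adjoint_cs_proj.
  exact: cs_val_set.
move=> C [[CA CA'] CT CS].
have CP : C \bo P = C by exact: comp_eq_of_perp CS PS.
have CP' : adjoint C \bo P' = adjoint C.
  by apply: comp_eq_of_perp PT; rewrite adjointK.
split.
  apply: dixmier_cos_subset CA => //; apply: closure_subset => _ [x _ <-].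
  by exists (P x) => //; rewrite -AP -{2}CP.
apply: dixmier_cos_subset CA' => //; apply: closure_subset => _ [x _ <-].
by exists (P' x) => //; rewrite -AP' -{2}CP'.
Qed.
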